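(* Assume the following. (1) The set $\mathrm{SOL}(F,\mathcal{C}\cap\mathcal{N})$ of solutions of the multi-stage stochastic variational inequality in extensive form, i.e. of pairs $(x^{\ast},y^{\ast})$ with $x^{\ast}\in\mathcal{C}\cap\mathcal{N}$, $y^{\ast}\in\mathcal{M}$ and $-F(x^{\ast})-y^{\ast}\in N_{\mathcal{C}}(x^{\ast})$, is nonempty. (2) $F:\mathcal{L}^{2}\to\mathcal{L}^{2}$ is monotone and Lipschitz continuous with constant $L_{F}>0$: $\langle F(x)-F(y),x-y\rangle_{\mathcal{L}^{2}}\geq 0$ and $\|F(x)-F(y)\|_{\mathcal{L}^{2}}\leq L_{F}\|x-y\|_{\mathcal{L}^{2}}$ for all $x,y\in\mathcal{L}^{2}$. (3) $r>0$; $\{\alpha_{k}\}_{k=0}^{\infty}\subseteq(0,1)$ satisfies $\lim_{k\to\infty}\alpha_{k}=0$ and $\sum_{k=0}^{\infty}\alpha_{k}=\infty$; $\{\beta_{k}\}_{k=0}^{\infty}\subseteq(0,2)$ satisfies $0<\liminf_{k\to\infty}\beta_{k}\leq\limsup_{k\to\infty}\beta_{k}<2$; $\{\theta_{k}\}_{k=0}^{\infty}\subseteq[0,1)$ satisfies $\sum_{k=0}^{\infty}\frac{\theta_{k}}{\alpha_{k}}\|(x^{k}-x^{k-1})-r^{-1}(y^{k}-y^{k-1})\|_{\mathcal{L}^{2}}<\infty$; and $\{\varepsilon_{k}\}_{k=0}^{\infty}\subseteq[0,+\infty)$ satisfies $\sum_{k=0}^{\infty}\varepsilon_{k}<\infty$.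 Here $\{(x^{k},y^{k})\}_{k=0}^{\infty}$ is the sequence generated by the Halpern-type relaxed inertial inexact progressive hedging algorithm described in the context, with these parameters. Then $\{(x^{k},y^{k})\}_{k=0}^{\infty}$ converges strongly (in the norm of $\mathcal{L}^{2}\times\mathcal{L}^{2}$) to some $(x^{\ast},y^{\ast})\in\mathrm{SOL}(F,\mathcal{C}\cap\mathcal{N})$. In particular, $\{x^{k}\}_{k=0}^{\infty}$ converges strongly in $\mathcal{L}^{2}$ to a solution $x^{\ast}$ of the multi-stage stochastic variational inequality: $x^{\ast}\in\mathcal{C}\cap\mathcal{N}$ and $-F(x^{\ast})\in N_{\mathcal{C}\cap\mathcal{N}}(x^{\ast})$.
   Context: Setting. $(\Omega,\mathscr{F},\mathbb{P})$ is a complete probability space, $\mathscr{O}$ the collection of its $\mathbb{P}$-null sets, $N\geq 1$, $n_{0},\ldots,n_{N-1}$ are positive integers with $n_{0}+\cdots+n_{N-1}=n$, and $\mathscr{O}\subset\mathscr{F}_{0}\subset\mathscr{F}_{1}\subset\cdots\subset\mathscr{F}_{N-1}\subset\mathscr{F}$ are sub-$\sigma$-algebras. $\mathcal{L}^{2}$ is the Hilbert space of square-integrable $\mathscr{F}$-measurable random vectors $\Omega\to\mathbb{R}^{n}$, with $\langle\xi,\eta\rangle_{\mathcal{L}^{2}}=\mathbb{E}\langle\xi,\eta\rangle$ and the induced norm; $x\in\mathcal{L}^{2}$ is written $x=(x_{0},\ldots,x_{N-1})$ with $x_{i}:\Omega\to\mathbb{R}^{n_{i}}$. The nonanticipativity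 subspace is the closed subspace $\mathcal{N}=\{x\in\mathcal{L}^{2}\mid x_{i}\text{ is }\mathscr{F}_{i}\text{-measurable for } i=0,\ldots,N-1\}$, and $\mathcal{M}=\mathcal{N}^{\perp}=\{y\in\mathcal{L}^{2}\mid\mathbb{E}[y_{i}|\mathscr{F}_{i}]=0\text{ a.s., } i=0,\ldots,N-1\}$; $P_{\mathcal{N}},P_{\mathcal{M}}$ are the orthogonal projections. For each $i$, $C_{i}:\Omega\rightsquigarrow\mathbb{R}^{n_{i}}$ is a given $\mathscr{F}_{i}$-measurable set-valued map with nonempty closed convex values, and $\mathcal{C}=\{x\in\mathcal{L}^{2}\mid x_{i}(\omega)\in C_{i}(\omega)\text{ a.s., } i=0,\ldots,N-1\}$ is assumed nonempty (it is closed and convex). For a closed convex set $\mathcal{D}\subseteq\mathcal{L}^{2}$, $\Pi_{\mathcal{D}}$ is the metric projection onto $\mathcal{D}$ and $N_{\mathcal{D}}(x)=\{\eta\in\mathcal{L}^{2}\mid\langle\eta,y-x\rangle_{\mathcal{L}^{2}}\leq 0\ \forall y\in\mathcal{D}\}$ if $x\in\mathcal{D}$, $N_{\mathcal{D}}(x)=\emptyset$ otherwise. Algorithm (Halpern-type relaxed inertial inexact progressive hedging algorithm). Start from $x^{-1},x^{0}\in\mathcal{N}$, $y^{-1},y^{0}\in\mathcal{M}$. For $k=0,1,\ldots$: set $\hat{x}^{k}=x^{k}+\theta_{k}(x^{k}-x^{k-1})$, $\hat{y}^{k}=y^{k}+\theta_{k}(y^{k}-y^{k-1})$; choose $\tilde{x}^{k}\in\mathcal{L}^2$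 with $\|\tilde{x}^{k}-\Pi_{\mathcal{C}}\{\hat{x}^{k}-r^{-1}[F(\tilde{x}^{k})+\hat{y}^{k}]\}\|_{\mathcal{L}^{2}}\leq\varepsilon_{k}$; let $z^{k}=\Pi_{\mathcal{C}}\{\hat{x}^{k}-r^{-1}[F(\tilde{x}^{k})+\hat{y}^{k}]\}$ and $e^{k}=F(\tilde{x}^{k})-F(z^{k})$; update $$x^{k+1}=\alpha_{k}x^{0}+(1-\alpha_{k})\big[(1-\beta_{k})\hat{x}^{k}+\beta_{k}P_{\mathcal{N}}(z^{k})\big],$$ $$y^{k+1}=\alpha_{k}y^{0}+(1-\alpha_{k})\big\{(1-\beta_{k})\hat{y}^{k}+\beta_{k}[\hat{y}^{k}+rP_{\mathcal{M}}(z^{k})+P_{\mathcal{M}}(e^{k})]\big\}.$$ The parameter $\theta_{k}$ is allowed to be chosen after $x^{k-1},x^{k},y^{k-1},y^{k}$ have been found. *)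

(* Defs.v *)
From HB Require Import structures.
From mathcomp Require Import all_boot all_order all_algebra.
From mathcomp Require Import all_classical all_reals all_analysis.

Set Implicit Arguments.
Unset Strict Implicit.
Unset Printing Implicit Defensive.

Import Order.TTheory GRing.Theory Num.Theory.
Import numFieldNormedType.Exports.

Local Open Scope classical_set_scope.
Local Open Scope ring_scope.

(* Elements of [L2 P m] are functions, not classes modulo a.e. equality: [ip]
   and [l2norm] are only a semi-inner product and a seminorm, and equality in
   the Hilbert space is [x = y %[ae P]], i.e. [l2norm (x - y) = 0].  A Lipschitz
   operator [F : L2 P m -> L2 P m] automatically respects that equality. *)
Section square_integrable_random_vectors.
Context d (T : measurableType d) (R : realType) (P : probability T R) (m : nat).

Definition l2pred : {pred T -> 'rV[R]_m} :=
  mem [set x : T -> 'rV[R]_m | forall j, (fun w => x w ord0 j) \in Lfun P 2%:E].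

Record L2 := MkL2 { l2fun :> T -> 'rV[R]_m ; l2funP : l2fun \in l2pred }.

HB.instance Definition _ := [isSub for l2fun].
HB.instance Definition _ := [Choice of L2 by <:].

Lemma l2pred_submod_closed : submod_closed l2pred.
Proof.
have le12 : (1 <= 2%:E :> \bar R)%E by rewrite lee_fin ler1n.
split.
  rewrite inE => j.
  rewrite [X in X \in _](_ : _ = 0); last by apply/funext => w; rewrite mxE.
  exact: (Lfun_submod_closed P le12).1.
move=> a x y; rewrite !inE => xL yL j.
rewrite [X in X \in _](_ : _ =
    a *: (fun w => x w ord0 j) + (fun w => y w ord0 j)); last first.
  by apply/funext => w; rewrite !mxE.
exact: (Lfun_submod_closed P le12).2 _ _ _ (xL j) (yL j).
Qed.

HB.instance Definition _ :=
  GRing.isSubmodClosed.Build _ _ l2pred l2pred_submod_closed.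
HB.instance Definition _ := [SubChoice_isSubLmodule of L2 by <:].

Implicit Types (x y : L2) (D : set L2).

Definition ip x y : R :=
  fine 'E_P[fun w => (\sum_(j < m) x w ord0 j * y w ord0 j)%R]%E.

Definition l2norm x : R := Num.sqrt (ip x x).

Definition l2norm2 (z : L2 * L2) : R :=
  Num.sqrt (l2norm z.1 ^+ 2 + l2norm z.2 ^+ 2).

Definition orthocomplement D : set L2 := [set y | forall x, D x -> ip x y = 0].

Definition is_metric_proj D x p :=
  D p /\ forall q, D q -> l2norm (x - p) <= l2norm (x - q).

(* [xget] selects a representative; [x] is a dummy default. *)
Definition metric_proj D x : L2 := xget x [set p | is_metric_proj D x p].

Definition is_orth_proj D x p := D p /\ orthocomplement D (x - p).

Definition orth_proj D x : L2 := xget x [set p | is_orth_proj D x p].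

Definition normal_cone D x : set L2 :=
  [set eta | D x /\ forall y, D y -> ip eta (y - x) <= 0].

End square_integrable_random_vectors.

Section multistage.
Context d (T : measurableType d) (R : realType) (P : probability T R).
Context (N : nat) (n : 'I_N -> nat).

Definition is_filtration (G : 'I_N -> set_system T) :=
  [/\ forall i, sigma_algebra setT (G i),
      forall i, P.-negligible `<=` G i,
      forall i j : 'I_N, (i <= j)%N -> G i `<=` G j &
      forall i, G i `<=` measurable].

Definition measurable_wrt (S : set_system T) k (f : T -> 'rV[R]_k) :=
  forall j, preimage_set_system setT (fun w => f w ord0 j) measurable `<=` S.

Definition measurable_setvalued (S : set_system T) k (C : T -> set 'rV[R]_k) :=
  forall O, open O -> S [set w | C w `&` O !=set0].

Let L2n := L2 P (\sum_(i < N) n i).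

Definition block (x : L2n) (i : 'I_N) (w : T) : 'rV[R]_(n i) :=
  submxrow (x w) i.

(* As [G i] contains the negligible sets, [nonanticip] does not depend on the
   choice of representatives. *)
Definition nonanticip (G : 'I_N -> set_system T) : set L2n :=
  [set x | forall i, measurable_wrt (G i) (block x i)].

Definition selections (C : forall i : 'I_N, T -> set 'rV[R]_(n i)) : set L2n :=
  [set x | forall i, {ae P, forall w, C i w (block x i w)}].

(* Solutions of the extensive form and of the basic form of the multi-stage
   stochastic variational inequality. *)
Definition SOL (F : L2n -> L2n) (C S : set L2n) : set (L2n * L2n) :=
  [set z | [/\ C z.1, S z.1, orthocomplement S z.2 &
               normal_cone C z.1 (- F z.1 - z.2)]].

Definition is_SVI_solution (F : L2n -> L2n) (C S : set L2n) (x : L2n) :=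
  (C `&` S) x /\ normal_cone (C `&` S) x (- F x).

End multistage.

Arguments nonanticip {d T R} P {N n} G.
Arguments selections {d T R} P {N n} C.

Section algorithm.
Context d (T : measurableType d) (R : realType) (P : probability T R) (m : nat).
Implicit Types x y : nat -> L2 P m.

(* [prev_iterate a x k] is x^{k-1}, where [a] stands for x^{-1}. *)
Definition prev_iterate (a : L2 P m) x (k : nat) : L2 P m :=
  if k is k'.+1 then x k' else a.

Definition extrapolate (theta : nat -> R) a x (k : nat) : L2 P m :=
  x k + theta k *: (x k - prev_iterate a x k).

(* [xm1], [ym1] are x^{-1}, y^{-1}; [xt] is the sequence of inexact subproblem
   solutions, on which each iterate implicitly depends through F(xt k). *)
Definition is_halpern_PHA (F : L2 P m -> L2 P m) (C S : set (L2 P m)) (r : R)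
    (alpha beta theta eps : nat -> R) (xm1 ym1 : L2 P m) x y xt :=
  let M := orthocomplement S in
  [/\ S xm1 /\ S (x 0%N), M ym1 /\ M (y 0%N) &
  forall k : nat,
    let xh := extrapolate theta xm1 x k in
    let yh := extrapolate theta ym1 y k in
    let z := metric_proj C (xh - r^-1 *: (F (xt k) + yh)) in
    let e := F (xt k) - F z in
    [/\ l2norm (xt k - z) <= eps k,
        (x k.+1 = alpha k *: x 0%N + (1 - alpha k) *:
           ((1 - beta k) *: xh + beta k *: orth_proj S z)
         %[ae P]) &
        (y k.+1 = alpha k *: y 0%N + (1 - alpha k) *:
           ((1 - beta k) *: yh
            + beta k *: (yh + r *: orth_proj M z + orth_proj M e))
         %[ae P])]].

End algorithm.

(* Main.v *)
Require Import Defs.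
From mathcomp Require Import all_boot all_order all_algebra.
From mathcomp Require Import all_classical all_reals all_analysis.
From mathcomp Require Import ring lra measurable_realfun.

Set Implicit Arguments.
Unset Strict Implicit.
Unset Printing Implicit Defensive.

Import Order.TTheory GRing.Theory Num.Theory.
Import numFieldNormedType.Exports.

Local Open Scope classical_set_scope.
Local Open Scope ring_scope.

(** The algorithm is a Halpern iteration of a relaxed proximal point method in
    disguise, and this is what makes it converge strongly.

    Write [S] for the nonanticipativity subspace, [u k := x k - r^-1 *: y k], and
    let [A] be the partial inverse, with respect to [S], of the monotone operator
    [r^-1 *: (F + normal_cone C)]: argument and value exchange their components
    along the orthogonal complement of [S]. A solution [(xs, ys)] of the extensive
    form is the same thing as a zero [xs - r^-1 *: ys] of [A]
    ([partial_inverse_of_SOL], [partial_inverse_zero]). Up to null sets, one step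
    of the algorithm reads
    [u' = a *: u0 + (1 - a) *: ((1 - b) *: uh + b *: q)], where [uh] is the
    inertial extrapolation and [q] is the resolvent of [A] at [uh - r^-1 *: e].
    Since [x k] lies in [S] and [y k] in its complement,
    convergence of [u] gives convergence of both components.

    Strong convergence of such an iteration ([halpern_proximal_cvg]) is usually
    obtained from weak compactness of bounded sets. Here it is proved through the
    resolvent path instead. The points [p n] with [(u0 - p n) / n.+1] in [A (p n)]
    exist because they amount to a strongly monotone variational inequality on
    [C] ([strongly_monotone_VI], [partial_inverse_resolvent]); their distance to
    [u0] is nondecreasing and bounded, which together with monotonicity makes them
    converge strongly to a zero [us] ([resolvent_path_cvg]). Let [y] be the
    displacement of a step. Monotonicity between the output of the step and [p n]
    bounds [ip (u0 - us) (u' - us)] by a multiple of [l2norm y], with a constant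
    depending on [n], up to terms that vanish ([halpern_step_ip_le]). The squared
    distance to [us] decreases by a multiple of [l2norm y ^+ 2]
    ([halpern_step_sqr_le]), so that completing the square absorbs the linear
    term at a cost of order [a ^+ 2] ([absorb_linear]). What is left is a scalar
    recursion [s' <= (1 - a) * s + a * eta + delta] with [delta] summable and
    [eta] as small as desired, which forces the upper limit of [s] below [eta]
    ([averaged_recursion]).

    Elements of [L2 P m] are functions rather than classes, so everything is done
    with a seminorm: completeness ([geometric_cauchy_cvg]) and the existence of
    projections are proved in that form, and equalities almost everywhere enter
    as differences of seminorm zero. *)

(** * The semi-inner product of square integrable random vectors *)

Section inner_product.
Context d (T : measurableType d) (R : realType) (P : probability T R) (m : nat).
Implicit Types (x y z : L2 P m) (a : R).

Lemma l2_coord x (j : 'I_m) : (fun w => x w ord0 j) \in Lfun P 2%:E.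
Proof. by have := l2funP x; rewrite inE; apply. Qed.

Lemma l2addE x y w : (x + y) w = x w + y w.
Proof. by []. Qed.

Lemma l2oppE x w : (- x) w = - x w.
Proof. by []. Qed.

Lemma l2scaleE a x w : (a *: x) w = a *: x w.
Proof. by []. Qed.

Lemma l2_ext x y : (forall w j, x w ord0 j = y w ord0 j) -> x = y.
Proof.
by move=> xy; apply: val_inj; apply/funext => w; apply/rowP => j; exact: xy.
Qed.

Lemma l2addEj x y w j : (x + y) w ord0 j = x w ord0 j + y w ord0 j.
Proof. by rewrite l2addE mxE. Qed.

Lemma l2oppEj x w j : (- x) w ord0 j = - x w ord0 j.
Proof. by rewrite l2oppE mxE. Qed.

Lemma l2scaleEj a x w j : (a *: x) w ord0 j = a * x w ord0 j.
Proof. by rewrite l2scaleE mxE. Qed.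

Definition l2coordE := (l2addEj, l2oppEj, l2scaleEj).

Lemma l2_coord_mul x y (j : 'I_m) :
  P.-integrable setT (EFin \o (fun w => x w ord0 j * y w ord0 j)).
Proof. by apply/Lfun1_integrable; apply: Lfun2_mul_Lfun1; exact: l2_coord. Qed.

Lemma ip_integrable x y :
  P.-integrable setT (EFin \o (fun w => \sum_(j < m) x w ord0 j * y w ord0 j)).
Proof.
rewrite [X in integrable _ _ X](_ : _ = fun w =>
    (\sum_(j < m) (x w ord0 j * y w ord0 j)%:E)%E); last first.
  by apply/funext => w /=; rewrite sumEFin.
by apply: integrable_sum => // j _; have := l2_coord_mul x y j.
Qed.

Lemma ipE x y :
  ip x y = (\int[P]_w (\sum_(j < m) x w ord0 j * y w ord0 j))%R.
Proof. by rewrite /ip unlock. Qed.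

Lemma ipC x y : ip x y = ip y x.
Proof.
rewrite !ipE; apply: eq_Rintegral => w _.
by apply: eq_bigr => j _; rewrite mulrC.
Qed.

Lemma ipDl x y z : ip (x + y) z = ip x z + ip y z.
Proof.
rewrite !ipE -RintegralD//; [|exact: ip_integrable..].
apply: eq_Rintegral => w _; rewrite -big_split.
by apply: eq_bigr => j _; rewrite l2addE mxE mulrDl.
Qed.

Lemma ipZl a x y : ip (a *: x) y = a * ip x y.
Proof.
rewrite !ipE -RintegralZl//; last exact: ip_integrable.
apply: eq_Rintegral => w _; rewrite mulr_sumr.
by apply: eq_bigr => j _; rewrite l2scaleE mxE mulrA.
Qed.

Lemma ipNl x y : ip (- x) y = - ip x y.
Proof. by rewrite -scaleN1r ipZl mulN1r. Qed.

Lemma ipDr x y z : ip z (x + y) = ip z x + ip z y.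
Proof. by rewrite ipC ipDl !(ipC z). Qed.

Lemma ipZr a x y : ip y (a *: x) = a * ip y x.
Proof. by rewrite ipC ipZl ipC. Qed.

Lemma ipNr x y : ip y (- x) = - ip y x.
Proof. by rewrite ipC ipNl ipC. Qed.

Lemma ip0l x : ip 0 x = 0.
Proof. by rewrite -(scale0r 0) ipZl mul0r. Qed.

Lemma ip0r x : ip x 0 = 0.
Proof. by rewrite ipC ip0l. Qed.

Lemma ip_ge0 x : 0 <= ip x x.
Proof.
rewrite ipE; apply: Rintegral_ge0 => w _.
by apply: sumr_ge0 => j _; exact: sqr_ge0.
Qed.

Definition ipE_linear := (ipDl, ipDr, ipNl, ipNr, ipZl, ipZr).

Lemma l2norm_ge0 x : 0 <= l2norm x.
Proof. exact: sqrtr_ge0. Qed.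

Lemma sqr_l2norm x : l2norm x ^+ 2 = ip x x.
Proof. by rewrite /l2norm sqr_sqrtr// ip_ge0. Qed.

Lemma l2norm0 : l2norm (0 : L2 P m) = 0.
Proof. by rewrite /l2norm ip0l sqrtr0. Qed.

Lemma l2normZ a x : l2norm (a *: x) = `|a| * l2norm x.
Proof. by rewrite /l2norm ipZl ipZr mulrA -expr2 sqrtrM ?sqr_ge0// sqrtr_sqr. Qed.

Lemma l2normN x : l2norm (- x) = l2norm x.
Proof. by rewrite -scaleN1r l2normZ normrN1 mul1r. Qed.

Lemma l2distC x y : l2norm (x - y) = l2norm (y - x).
Proof. by rewrite -l2normN opprB. Qed.

Lemma ler_l2norm x a : 0 <= a -> ip x x <= a ^+ 2 -> l2norm x <= a.
Proof.
by move=> a0 xa; rewrite -(ler_pXn2r (n := 2)) ?nnegrE ?l2norm_ge0// sqr_l2norm.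
Qed.

(** Positivity of [ip] at [a *: x - b *: y] with [a], [b] the norms of [y] and
    [x], both increased by [e] so that vanishing norms need no special case. *)
Lemma cauchy_schwarz x y : ip x y <= l2norm x * l2norm y.
Proof.
have H a b : 2 * (a * b) * ip x y <= a ^+ 2 * l2norm x ^+ 2 + b ^+ 2 * l2norm y ^+ 2.
  have := ip_ge0 (a *: x - b *: y).
  by rewrite !ipE_linear (ipC y x) !sqr_l2norm; lra.
have := l2norm_ge0 x; have := l2norm_ge0 y.
set p := l2norm x in H *; set q := l2norm y in H *; set t := ip x y in H *.
move=> q0 p0.
have K e : 0 < e -> t <= p * q + e * (p + q) / 2.
  move=> e0; have := H (q + e) (p + e); set c := _ * t.
  have m0 : 0 < (q + e) * (p + e) by rewrite mulr_gt0 ?ltr_wpDl.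
  move=> cle; rewrite -(ler_pM2l m0); rewrite /c in cle.
  have hp : 0 <= (q + e) ^+ 2 * p * e.
    by rewrite mulr_ge0 ?(ltW e0)// mulr_ge0 ?sqr_ge0.
  have hq : 0 <= (p + e) ^+ 2 * q * e.
    by rewrite mulr_ge0 ?(ltW e0)// mulr_ge0 ?sqr_ge0.
  by lra.
apply/ler_addgt0Pr => e e0.
have s0 : 0 < p + q + 1 by rewrite ltr_wpDl ?addr_ge0.
have c0 : 0 < e / (p + q + 1) by exact: divr_gt0.
have : e / (p + q + 1) * (p + q + 1) = e by rewrite divfK ?gt_eqF.
have := K _ c0; have := mulr_ge0 (ltW c0) p0; have := mulr_ge0 (ltW c0) q0.
by lra.
Qed.

Lemma cauchy_schwarz_norm x y : `|ip x y| <= l2norm x * l2norm y.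
Proof.
rewrite ler_norml cauchy_schwarz andbT lerNl -ipNl -(l2normN x).
exact: cauchy_schwarz.
Qed.

Lemma ler_l2normD x y : l2norm (x + y) <= l2norm x + l2norm y.
Proof.
apply: ler_l2norm; first by rewrite addr_ge0 ?l2norm_ge0.
rewrite !ipE_linear (ipC y x) sqrrD !sqr_l2norm.
by have := cauchy_schwarz x y; lra.
Qed.

Lemma ler_l2normB x y : l2norm (x - y) <= l2norm x + l2norm y.
Proof. by rewrite -(l2normN y); exact: ler_l2normD. Qed.

Lemma ler_l2dist y x z : l2norm (x - z) <= l2norm (x - y) + l2norm (y - z).
Proof. by rewrite (_ : x - z = (x - y) + (y - z)) ?ler_l2normD// subrKA. Qed.

(** With this, [ip] is insensitive to the choice of a representative modulo
    almost everywhere equality. *)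
Lemma ip_null x y : l2norm x = 0 -> ip x y = 0.
Proof.
move=> x0; apply/eqP; rewrite -normr_le0.
by have := cauchy_schwarz_norm x y; rewrite x0 mul0r.
Qed.

Lemma l2norm_ae_eq x y : x = y %[ae P] -> l2norm (x - y) = 0.
Proof.
move=> xy; rewrite /l2norm ipE /Rintegral.
rewrite (ae_eq_integral (cst 0)%E)//=.
- by rewrite integral0 sqrtr0.
- by have /integrableP[] := ip_integrable (x - y) (x - y).
- apply: filterS xy => w /(_ I) xyw _.
  have xyw0 : (x - y) w = 0 by rewrite l2addE l2oppE xyw subrr.
  rewrite -[LHS]/((\sum_(j < m) (x - y) w ord0 j * (x - y) w ord0 j)%:E).
  by rewrite xyw0 big1// => j _; rewrite mxE mul0r.
Qed.

Lemma ae_eq_l2norm x y : l2norm (x - y) = 0 -> x = y %[ae P].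
Proof.
set z := x - y => z0.
have iz : ip z z = 0 by rewrite -sqr_l2norm z0 expr0n.
have : (\int[P]_w `|(\sum_(j < m) z w ord0 j * z w ord0 j)%:E| = 0)%E.
  transitivity ((ip z z)%:E); last by rewrite iz.
  rewrite ipE fineK; last exact: integrable_fin_num (ip_integrable z z).
  apply: eq_integral => w _; congr EFin.
  by apply: ger0_norm; apply: sumr_ge0 => j _; exact: sqr_ge0.
have /integrableP[mz _] := ip_integrable z z.
move/(ae_eq_integral_abs P measurableT mz).1; apply: filterS => w zw _.
have zw0 : \sum_(j < m) z w ord0 j * z w ord0 j = 0 by have [] := zw I.
apply/rowP => j.
have /(_ j isT)/eqP := @psumr_eq0P _ _ xpredT _ (fun j _ => sqr_ge0 (z w ord0 j)) zw0.
rewrite sqrf_eq0 => /eqP zj; apply/eqP; rewrite -subr_eq0; apply/eqP.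
by rewrite -zj /z l2addE l2oppE !mxE.
Qed.
End inner_product.

(** Vector identities in [L2] are ring identities in every coordinate. *)
Ltac l2_ring := apply: l2_ext => ? ?; rewrite !l2coordE; ring.

(** * Completeness *)

Lemma geometric_sum_le (R : realFieldType) (q : R) n :
  0 <= q < 1 -> \sum_(0 <= k < n) q ^+ k <= (1 - q)^-1.
Proof.
move=> /andP[q0 q1]; have q1' : 0 < 1 - q by rewrite subr_gt0.
rewrite -[leRHS]mul1r ler_pdivlMr// mulrC big_mkord.
have := subrX1 q n; have := exprn_ge0 n q0; lra.
Qed.

Section completeness.
Context d (T : measurableType d) (R : realType) (P : probability T R) (m : nat).
Implicit Types (u : nat -> L2 P m) (c q : R).

Lemma l2dist_geometric u c q : 0 <= c -> 0 <= q < 1 ->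
  (forall k, l2norm (u k.+1 - u k) <= c * q ^+ k) ->
  forall k n, (k <= n)%N -> l2norm (u n - u k) <= c / (1 - q) * q ^+ k.
Proof.
move=> c0 /[dup] q01 /andP[q0 q1] uq k n /subnKC <-; move: (n - k)%N => p.
have : l2norm (u (k + p)%N - u k) <= c * q ^+ k * \sum_(0 <= i < p) q ^+ i.
  elim: p => [|p ih]; first by rewrite addn0 subrr l2norm0 big_geq// mulr0.
  rewrite addnS big_nat_recr//= mulrDr.
  have : c * q ^+ (k + p) = c * q ^+ k * q ^+ p by rewrite exprD mulrA.
  have := ler_l2dist (u (k + p)%N) (u (k + p).+1) (u k); have := uq (k + p)%N.
  by move: ih; move: (l2norm _) (l2norm _) (l2norm _) => ? ? ?; lra.
move=> /le_trans; apply.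
rewrite mulrAC ler_wpM2r ?exprn_ge0// ler_wpM2l//.
exact: geometric_sum_le.
Qed.

Lemma square_integrable_Lfun2 (g : T -> R) : measurable_fun setT g ->
  (\int[P]_w (g w ^+ 2)%:E < +oo)%E -> g \in Lfun P 2%:E.
Proof.
move=> mg gy; rewrite inE; apply/andP; split; first by rewrite inE.
rewrite inE/= /finite_norm unlock /Lnorm poweR_lty//=.
under eq_integral => w _ do rewrite powR_mulrn// real_normK ?num_real//.
exact: gy.
Qed.

Definition sqdist (x y : T -> 'rV[R]_m) (w : T) : R :=
  \sum_(j < m) (x w ord0 j - y w ord0 j) ^+ 2.

Lemma ip_sqdist (x y : L2 P m) :
  ((ip (x - y) (x - y))%:E = \int[P]_w (sqdist x y w)%:E)%E.
Proof.
rewrite ipE fineK; last exact: integrable_fin_num (ip_integrable _ _).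
apply: eq_integral => w _; congr EFin; apply: eq_bigr => j _.
by rewrite l2addE l2oppE !mxE expr2.
Qed.

Lemma measurable_coord (x : L2 P m) j : measurable_fun setT (fun w => x w ord0 j).
Proof. by have := l2_coord x j; rewrite inE => /andP[+ _]; rewrite inE. Qed.

Lemma measurable_sqdist (x y : T -> 'rV[R]_m) :
  (forall j, measurable_fun setT (fun w => x w ord0 j)) ->
  (forall j, measurable_fun setT (fun w => y w ord0 j)) ->
  measurable_fun setT (sqdist x y).
Proof.
move=> mx my; apply: measurable_sum => j.
by apply: measurable_funX; apply: measurable_funB.
Qed.

Lemma sqdist_ge0 x y w : 0 <= sqdist x y w.
Proof. by apply: sumr_ge0 => j _; exact: sqr_ge0. Qed.

(** Dividing the squared increments by their geometric bounds [c * q ^+ k]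
    keeps the integral of their sum finite; the sum is then finite almost
    everywhere, and by the arithmetic-geometric mean inequality so is the sum of
    the increments themselves. *)
Lemma geometric_cauchy_ae u c q : 0 < c -> 0 < q < 1 ->
  (forall k, l2norm (u k.+1 - u k) <= c * q ^+ k) ->
  {ae P, forall w, forall j, cvgn (fun k => u k w ord0 j)}.
Proof.
move=> c0 /[dup] q01 /andP[q0 q1] uq.
have q1' : 0 < 1 - q by rewrite subr_gt0.
have cq0 k : 0 < c * q ^+ k by rewrite mulr_gt0 ?exprn_gt0.
pose f k w := (sqdist (u k.+1) (u k) w / (c * q ^+ k))%:E.
have f0 k w : (0 <= f k w)%E.
  by rewrite lee_fin divr_ge0 ?sqdist_ge0 ?(ltW (cq0 k)).
have mf k : measurable_fun setT (f k).
  apply/measurable_EFinP; apply: measurable_funM => //.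
  by apply: measurable_sqdist; exact: measurable_coord.
have fle k : (\int[P]_w f k w <= (c * q ^+ k)%:E)%E.
  rewrite /f; under eq_integral do rewrite EFinM muleC.
  rewrite ge0_integralZl//; last 3 first.
  - apply/measurable_EFinP; apply: measurable_sqdist; exact: measurable_coord.
  - by move=> w _; rewrite lee_fin sqdist_ge0.
  - by rewrite lee_fin invr_ge0 ltW.
  rewrite -ip_sqdist -EFinM lee_fin mulrC ler_pdivrMr// -expr2 -sqr_l2norm.
  by rewrite ler_pXn2r ?nnegrE ?l2norm_ge0 ?(ltW (cq0 k)).
have sumf : (\int[P]_w (\sum_(k <oo) f k w) <= (c / (1 - q))%:E)%E.
  rewrite integral_nneseries//; apply: lime_le.
    by apply: is_cvg_nneseries => k _ _; exact: integral_ge0.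
  apply: nearW => n; apply: (@le_trans _ _ (\sum_(0 <= k < n) (c * q ^+ k)%:E)%E).
    by apply: lee_sum => k _; exact: fle.
  rewrite sumEFin lee_fin -mulr_sumr ler_wpM2l ?(ltW c0)//.
  by apply: geometric_sum_le; rewrite q1 ltW.
have isumf : P.-integrable setT (fun w => \sum_(k <oo) f k w)%E.
  apply/integrableP; split; first exact: ge0_emeasurable_sum.
  under eq_integral do rewrite gee0_abs ?nneseries_ge0//.
  exact: le_lt_trans sumf (ltry _).
apply: filterS (integrable_ae measurableT isumf) => w /(_ I) sumw j.
set S := (\sum_(k <oo) f k w)%E in sumw.
rewrite (_ : (fun k => u k w ord0 j) =
    (fun n => u 0%N w ord0 j + series (telescope (fun k => u k w ord0 j)) n));
        last first.
  by apply/funext => n; rewrite -eq_sum_telescope.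
apply: is_cvgD; first exact: is_cvg_cst.
apply: normed_cvg; apply: nondecreasing_is_cvgn.
  by apply: nondecreasing_series => k _ _; exact: normr_ge0.
exists ((fine S + c / (1 - q)) / 2) => _ [n _ <-].
rewrite /series/=.
apply: (@le_trans _ _ (\sum_(0 <= k < n)
    ((sqdist (u k.+1) (u k) w / (c * q ^+ k) + c * q ^+ k) / 2))).
  apply: ler_sum => k _; rewrite /telescope/=.
  set t := _ - _.
  have : t ^+ 2 <= sqdist (u k.+1) (u k) w.
    rewrite /sqdist (bigD1 j)//= lerDl.
    by apply: sumr_ge0 => i _; exact: sqr_ge0.
  move: (sqdist _ _ _) (cq0 k) => s; set a := c * _ => a0 ts.
  have sa : s / a * a = s by rewrite divfK ?gt_eqF.
  rewrite -(ler_pM2r a0).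
  have : 0 <= (`|t| - a) ^+ 2 by exact: sqr_ge0.
  by rewrite sqrrB real_normK ?num_real//; lra.
rewrite -mulr_suml big_split/= ler_pdivlMr// divfK// lerD//.
  rewrite -lee_fin fineK// -sumEFin.
  by apply: (@nneseries_lim_ge _ (fun k => f k w) xpredT 0%N n) => k _ _.
rewrite -mulr_sumr ler_wpM2l ?(ltW c0)//.
by apply: geometric_sum_le; rewrite q1 ltW.
Qed.

(** Riesz-Fischer. The limit is defined pointwise by an upper limit, which is
    measurable without discussing where the sequence converges; its square
    integrability and the rate of convergence both come from Fatou's lemma. *)
Theorem geometric_cauchy_cvg u c q : 0 < c -> 0 < q < 1 ->
  (forall k, l2norm (u k.+1 - u k) <= c * q ^+ k) ->
  exists f : L2 P m,
    (forall k, l2norm (u k - f) <= c / (1 - q) * q ^+ k) /\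
    {ae P, forall w, forall j, (fun k => u k w ord0 j) @ \oo --> f w ord0 j}.
Proof.
move=> c0 /[dup] q01 /andP[q0 q1] uq.
have q1' : 0 < 1 - q by rewrite subr_gt0.
pose f w : 'rV[R]_m := \row_j fine (limn_esup (fun k => (u k w ord0 j)%:E)).
have mf j : measurable_fun setT (fun w => f w ord0 j).
  under eq_fun do rewrite mxE.
  apply: measurableT_comp; first exact: fine_measurable.
  apply: measurable_fun_limn_esup => k; apply/measurable_EFinP.
  exact: measurable_coord.
have uf : {ae P, forall w, forall j, (fun k => u k w ord0 j) @ \oo --> f w ord0 j}.
  apply: filterS (geometric_cauchy_ae c0 q01 uq) => w uw j; rewrite mxE.
  have : (fun k => (u k w ord0 j)%:E) @ \oo --> (limn (fun k => u k w ord0 j))%:E.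
    by apply: cvg_EFin => //; [exact: nearW|exact: uw].
  by move=> /cvg_limn_einf_sup[_ ->]; exact: uw.
have fatou_f k : (\int[P]_w (sqdist (u k) f w)%:E <=
    ((c / (1 - q) * q ^+ k) ^+ 2)%:E)%E.
  have ms n : measurable_fun setT (fun w => (sqdist (u k) (u (n + k)%N) w)%:E).
    apply/measurable_EFinP; apply: measurable_sqdist; exact: measurable_coord.
  have msf : measurable_fun setT (fun w => (sqdist (u k) f w)%:E).
    by apply/measurable_EFinP; apply: measurable_sqdist => // j;
        exact: measurable_coord.
  apply: (@le_trans _ _ (\int[P]_w
      limn_einf (fun n => (sqdist (u k) (u (n + k)%N) w)%:E))%E).
    rewrite le_eqVlt; apply/orP; left; apply/eqP.
    apply: ge0_ae_eq_integral => //.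
    - apply: measurableT_comp => //.
      by apply: measurable_fun_limn_esup => n; apply: measurableT_comp => //; exact: ms.
    - by move=> w _; rewrite lee_fin sqdist_ge0.
    - move=> w _; rewrite limn_einf_lim; apply: lime_ge; first exact: is_cvg_einfs.
      apply: nearW => n; apply: le_ereal_inf_tmp => _ [i _ <-].
      by rewrite lee_fin sqdist_ge0.
    apply: filterS uf => w uw _; apply/esym.
    apply: (cvg_limn_einf_sup _).1; apply: cvg_EFin; first exact: nearW.
    have cvg_j j : (fun n => (u k w ord0 j - u (n + k)%N w ord0 j) ^+ 2) @ \oo -->
        (u k w ord0 j - f w ord0 j) ^+ 2.
      have uwk : (fun n => u (n + k)%N w ord0 j) @ \oo --> f w ord0 j.
        by move: (uw j); rewrite -(cvg_shiftn k).
      have dwk : (fun n => u k w ord0 j - u (n + k)%N w ord0 j) @ \oo -->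
          u k w ord0 j - f w ord0 j.
        by apply: cvgB; [exact: cvg_cst|exact: uwk].
      exact: (cvgM dwk dwk).
    by apply: cvg_big => //; exact: add_continuous.
  apply: le_trans (fatou _ _ _ _) _ => //.
    by move=> n w _; rewrite lee_fin sqdist_ge0.
  rewrite limn_einf_lim; apply: lime_le; first exact: is_cvg_einfs.
  apply: nearW => n; apply: (@le_trans _ _ (\int[P]_w (sqdist (u k) (u (n
      + k)%N) w)%:E)%E).
    by apply: ereal_inf_lbound; exists n => /=.
  rewrite -ip_sqdist lee_fin -sqr_l2norm l2distC.
  rewrite ler_pXn2r ?nnegrE ?l2norm_ge0//.
    by apply: l2dist_geometric; rewrite ?leq_addl ?(ltW c0) ?(ltW q0).
  by rewrite mulr_ge0 ?divr_ge0 ?exprn_ge0 ?(ltW c0) ?(ltW q0) ?(ltW q1').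
have fL2 : f \in l2pred P (m:=m).
  rewrite inE => j.
  rewrite (_ : (fun w => f w ord0 j) =
    (- 1) *: (fun w => u 0%N w ord0 j - f w ord0 j) + (fun w => u 0%N w ord0 j));
        last first.
    apply/funext => w.
    rewrite -[RHS]/(- 1 * (u 0%N w ord0 j - f w ord0 j) + u 0%N w ord0 j).
    by rewrite mulN1r opprB subrK.
  have le12 : (1 <= 2%:E :> \bar R)%E by rewrite lee_fin ler1n.
  apply: (Lfun_submod_closed P le12).2; last exact: l2_coord.
  apply: square_integrable_Lfun2.
    by apply: measurable_funB => //; exact: measurable_coord.
  apply: le_lt_trans (le_lt_trans (fatou_f 0%N) (ltry _)).
  apply: ge0_le_integral => //.
  - by move=> w _; rewrite lee_fin sqr_ge0.
  - apply/measurable_EFinP; apply: measurable_funX; apply: measurable_funB => //.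
    exact: measurable_coord.
  - by apply/measurable_EFinP; apply: measurable_sqdist => // i;
      exact: measurable_coord.
  - move=> w _; rewrite lee_fin /sqdist (bigD1 j)//= lerDl.
    by apply: sumr_ge0 => i _; exact: sqr_ge0.
exists (MkL2 fL2); split; last exact: uf.
move=> k; apply: ler_l2norm.
  by rewrite mulr_ge0 ?divr_ge0 ?exprn_ge0 ?(ltW c0) ?(ltW q0) ?(ltW q1').
by rewrite -lee_fin ip_sqdist; exact: fatou_f.
Qed.

End completeness.

Lemma cvg0P (R : realType) (a : nat -> R) : (forall k, 0 <= a k) ->
  (a @ \oo --> (0 : R)) <->
  (forall e, 0 < e -> exists K, forall k, (K <= k)%N -> a k < e).
Proof.
move=> a0; split.
  move=> /cvgr0Pnorm_lt ae e e0; have [K _ Ke] := ae _ e0.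
  by exists K => k Kk; rewrite -[a k]ger0_norm//; exact: Ke.
move=> ae; apply/cvgr0Pnorm_lt => e /ae[K Ke].
by exists K => // k /= Kk; rewrite ger0_norm//; exact: Ke.
Qed.

Section subsequences.
Context d (T : measurableType d) (R : realType) (P : probability T R) (m : nat).
Implicit Types (u : nat -> L2 P m) (x : L2 P m).

Definition l2_cvg u x := (fun k => l2norm (u k - x)) @ \oo --> (0 : R).

Lemma l2_cvgP u x : l2_cvg u x <->
  (forall e, 0 < e -> exists K, forall k, (K <= k)%N -> l2norm (u k - x) < e).
Proof. by apply: cvg0P => k; exact: l2norm_ge0. Qed.

(** A subsequence with geometric increments converges, also pointwise almost
    everywhere, and its limit is then the limit of the whole Cauchy sequence. *)
Lemma l2_cauchy_cvg u :
  (forall e, 0 < e ->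
     exists K, forall i j, (K <= i)%N -> (K <= j)%N -> l2norm (u i - u j) < e) ->
  exists f (phi : nat -> nat),
    l2_cvg u f /\
    {ae P, forall w, forall j, (fun k => u (phi k) w ord0 j) @ \oo --> f w ord0 j}.
Proof.
move=> uC.
have h0 k : 0 < 2^-1 ^+ k :> R by rewrite exprn_gt0.
have /choice[K KP] := fun k => uC _ (h0 k).
pose phi k := (\sum_(i < k.+1) K i)%N.
have Kphi k : (K k <= phi k)%N by rewrite /phi big_ord_recr/= leq_addl.
have phiS k : (phi k <= phi k.+1)%N by rewrite /phi [leqRHS]big_ord_recr/= leq_addr.
have uphi k : l2norm ((u \o phi) k.+1 - (u \o phi) k) <= 1 * 2^-1 ^+ k.
  by rewrite mul1r ltW//= KP//; exact: leq_trans (phiS k).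
have [|f [uf aef]] := geometric_cauchy_cvg ltr01 _ uphi; first by lra.
exists f, phi; split=> //; apply/l2_cvgP => e e0.
have : geometric (1 + 1 / (1 - 2^-1) : R) 2^-1 @ \oo --> (0 : R).
  by apply: cvg_geometric; rewrite ger0_norm//; lra.
move=> /cvgr0Pnorm_lt/(_ _ e0)[i _ /(_ i (leqnn i))/=].
move=> /(le_lt_trans (ler_norm _)); rewrite mulrDl !mul1r => ie.
exists (K i) => k Kik; apply: le_lt_trans ie.
apply: le_trans (ler_l2dist (u (phi i)) _ _) _.
have ufi := uf i; rewrite mul1r in ufi.
by apply: lerD => //; apply: ltW; exact: KP.
Qed.

Lemma l2_cvg_cauchy u x : l2_cvg u x ->
  forall e, 0 < e ->
    exists K, forall i j, (K <= i)%N -> (K <= j)%N -> l2norm (u i - u j) < e.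
Proof.
move=> /l2_cvgP ux e e0; have e20 : 0 < e / 2 by rewrite divr_gt0.
have [K KP] := ux _ e20; exists K => i j Ki Kj.
have := ler_l2dist x (u i) (u j); rewrite (l2distC x (u j)).
have := KP _ Ki; have := KP _ Kj.
by move: (l2norm _) (l2norm _) (l2norm _) => ? ? ?; lra.
Qed.

Lemma l2_cvg_unique u x y : l2_cvg u x ->
  l2_cvg u y -> l2norm (x - y) = 0.
Proof.
move=> /l2_cvgP ux /l2_cvgP uy; apply/eqP; rewrite eq_le l2norm_ge0 andbT.
apply/ler_addgt0Pr => e e0; rewrite add0r.
have e20 : 0 < e / 2 by rewrite divr_gt0.
have [K KP] := ux _ e20; have [L LP] := uy _ e20.
have := ler_l2dist (u (maxn K L)) x y; rewrite (l2distC x (u _)).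
have := KP _ (leq_maxl K L); have := LP _ (leq_maxr K L).
by move: (l2norm _) (l2norm _) (l2norm _) => ? ? ?; lra.
Qed.

(** This transfers pointwise closed constraints (measurability, values in closed
    sets) to limits in the seminorm. *)
Lemma l2_cvg_subseq_ae u x : l2_cvg u x ->
  exists phi : nat -> nat,
    {ae P, forall w, forall j, (fun k => u (phi k) w ord0 j) @ \oo --> x w ord0 j}.
Proof.
move=> ux; have [f [phi [uf aef]]] := l2_cauchy_cvg (l2_cvg_cauchy ux).
exists phi; apply: filterS2 aef (ae_eq_l2norm (l2_cvg_unique uf ux)) => w uw fx j.
by rewrite -fx//; exact: uw.
Qed.

End subsequences.

(** * Convex projections *)

Section limits.
Context d (T : measurableType d) (R : realType) (P : probability T R) (m : nat).
Implicit Types (u v : nat -> L2 P m) (x y : L2 P m).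

Lemma l2_cvg_le u x (b : nat -> R) :
  (forall k, l2norm (u k - x) <= b k) -> b @ \oo --> (0 : R) -> l2_cvg u x.
Proof.
move=> ub b0; apply: (squeeze_cvgr _ (cvg_cst 0) b0).
by apply: nearW => k; rewrite l2norm_ge0 ub.
Qed.

Lemma l2_cvg_cst x : l2_cvg (fun=> x) x.
Proof. by apply: (l2_cvg_le (b := cst 0)) => [k|];
    [rewrite subrr l2norm0|exact: cvg_cst]. Qed.

Lemma l2_cvgD u v x y : l2_cvg u x -> l2_cvg v y -> l2_cvg (fun k => u k + v k) (x + y).
Proof.
move=> ux vy; apply: l2_cvg_le (_ : (fun k => l2norm (u k - x)
    + l2norm (v k - y)) @ \oo --> 0).
  by move=> k; rewrite opprD addrACA; exact: ler_l2normD.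
by rewrite -[0]addr0; apply: cvgD.
Qed.

Lemma l2_cvgZ u x (a : R) : l2_cvg u x -> l2_cvg (fun k => a *: u k) (a *: x).
Proof.
move=> ux; apply: l2_cvg_le (_ : (fun k => `|a| * l2norm (u k - x)) @ \oo --> 0).
  by move=> k; rewrite -scalerBr l2normZ.
by rewrite -[0](mulr0 `|a|); apply: cvgM => //; exact: cvg_cst.
Qed.

Lemma l2_cvgN u x : l2_cvg u x -> l2_cvg (fun k => - u k) (- x).
Proof.
move=> ux; apply: l2_cvg_le ux => k.
by rewrite -opprD l2normN.
Qed.

Lemma l2_cvgB u v x y : l2_cvg u x -> l2_cvg v y -> l2_cvg (fun k => u k - v k) (x - y).
Proof. by move=> ux vy; apply: l2_cvgD => //; exact: l2_cvgN. Qed.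

Lemma l2_cvg_lipschitz (F : L2 P m -> L2 P m) (L : R) u x :
  (forall x y, l2norm (F x - F y) <= L * l2norm (x - y)) ->
  l2_cvg u x -> l2_cvg (F \o u) (F x).
Proof.
move=> FL ux; apply: l2_cvg_le (_ : (fun k => L * l2norm (u k - x)) @ \oo --> 0).
  by move=> k; exact: FL.
by rewrite -[0](mulr0 L); apply: cvgM => //; exact: cvg_cst.
Qed.

Lemma l2_cvg_ip u v x y : l2_cvg u x -> l2_cvg v y ->
  (fun k => ip (u k) (v k)) @ \oo --> ip x y.
Proof.
move=> ux vy.
pose b k := l2norm (u k - x) * l2norm (v k - y) + l2norm (u k - x) * l2norm y
  + l2norm x * l2norm (v k - y).
have b0 : b @ \oo --> (0 : R).
  have : b @ \oo --> (0 * 0 + 0 * l2norm y + l2norm x * 0 : R).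
    by apply: cvgD; [apply: cvgD|]; apply: cvgM => //; exact: cvg_cst.
  by rewrite !mul0r mulr0 !addr0.
apply/subr_cvg0/cvgr0Pnorm_le => e e0.
move/cvgr0Pnorm_le : b0 => /(_ _ e0); apply: filterS => k.
move=> /(le_trans (ler_norm _)); apply: le_trans.
rewrite (_ : _ - _ = ip (u k - x) (v k - y) + ip (u k - x) y + ip x (v k - y));
    last first.
  by rewrite !ipE_linear; lra.
apply: le_trans (ler_normD _ _) _; rewrite lerD ?cauchy_schwarz_norm//.
by apply: le_trans (ler_normD _ _) _; rewrite lerD ?cauchy_schwarz_norm.
Qed.

End limits.

Section convex_projection.
Context d (T : measurableType d) (R : realType) (P : probability T R) (m : nat).
Implicit Types (x y p q : L2 P m) (D S : set (L2 P m)).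

Definition l2_closed D :=
  forall u x, (forall k, D (u k)) -> l2_cvg u x -> D x.

Definition l2_convex D := forall x y (t : R),
  D x -> D y -> 0 <= t <= 1 -> D (t *: x + (1 - t) *: y).

Lemma cvg_half_powers (a : R) : (fun k => a * 2^-1 ^+ k) @ \oo --> (0 : R).
Proof. by apply: cvg_geometric; rewrite ger0_norm//; lra. Qed.

Lemma metric_projP D x : D !=set0 -> l2_closed D -> l2_convex D ->
  is_metric_proj D x (metric_proj D x).
Proof.
move=> [q0 Dq0] clD cvD; suff [p Dp] : exists p, is_metric_proj D x p.
  exact: (xgetI x Dp).
pose E := [set ip (x - q) (x - q) | q in D].
have infE : has_inf E.
  by split; [exists (ip (x - q0) (x - q0)), q0|exists 0 => _ [q _ <-]; exact: ip_ge0].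
have h0 k : 0 < 4^-1 ^+ k :> R by rewrite exprn_gt0.
have /choice[p pP] : forall k, exists q, D q /\ ip (x - q) (x - q) < inf E + 4^-1 ^+ k.
  by move=> k; have [_ [q Dq <-] qE] := inf_adherent (h0 k) infE; exists q.
have infle q : D q -> inf E <= ip (x - q) (x - q).
  by move=> Dq; apply: ge_inf; [exact: infE.2|exists q].
(* Parallelogram identity: the midpoint of two almost minimizers is no better
   than the infimum, hence they are close to each other. *)
have pC k : l2norm (p k.+1 - p k) <= 2 * 2^-1 ^+ k.
  apply: ler_l2norm; first by rewrite mulr_ge0 ?exprn_ge0.
  rewrite exprMn -exprM mulnC exprM (_ : 2^-1 ^+ 2 = 4^-1 :> R); last by lra.
  have [Dpk pk] := pP k; have [Dpk1 pk1] := pP k.+1.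
  have half : 0 <= (2^-1 : R) <= 1 by apply/andP; split; lra.
  have := infle _ (cvD _ _ _ Dpk Dpk1 half).
  move: pk pk1; rewrite exprS !ipE_linear.
  rewrite !(ipC _ x) (ipC (p k.+1) (p k)).
  by have := h0 k; lra.
have half1 : 0 < (2^-1 : R) < 1 by apply/andP; split; lra.
have [|f [pf _]] := geometric_cauchy_cvg _ half1 pC => //.
exists f; split.
  apply: clD (fun k => (pP k).1) _.
  exact: l2_cvg_le pf (cvg_half_powers _).
move=> q Dq; apply/ler_addgt0Pr => e e0.
have /cvgr0Pnorm_lt/(_ _ e0)[k _ /(_ k (leqnn k))/=] :=
  cvg_half_powers (1 + 2 / (1 - 2^-1)).
move=> /(le_lt_trans (ler_norm _)); rewrite mulrDl mul1r => ke.
have : l2norm (x - p k) <= l2norm (x - q) + 2^-1 ^+ k.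
  have [_ pk] := pP k.
  apply: ler_l2norm; first by rewrite addr_ge0 ?l2norm_ge0 ?exprn_ge0.
  have := infle _ Dq; rewrite -(sqr_l2norm (x - q)) sqrrD.
  have : (2^-1 ^+ k) ^+ 2 = 4^-1 ^+ k :> R.
    by rewrite -exprM mulnC exprM; congr (_ ^+ _); lra.
  have : 0 <= l2norm (x - q) * 2^-1 ^+ k by rewrite mulr_ge0 ?l2norm_ge0 ?exprn_ge0.
  by lra.
move: ke (ler_l2dist (p k) x f) (pf k).
by move: (l2norm _) (l2norm _) (l2norm _) (l2norm _) => ? ? ? ?; lra.
Qed.

(** The first order optimality condition: [p] is compared with the points
    [p + t *: (q - p)] for small [t]. *)
Lemma metric_proj_normal_cone D x p : l2_convex D -> is_metric_proj D x p ->
  normal_cone D p (x - p).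
Proof.
move=> cvD [Dp pmin]; split=> // q Dq.
have : forall t : R, 0 <= t <= 1 ->
    2 * (t * ip (x - p) (q - p)) <= t ^+ 2 * ip (q - p) (q - p).
  move=> t t01; have := pmin _ (cvD _ _ _ Dq Dp t01).
  rewrite (_ : x - (t *: q + (1 - t) *: p) = (x - p) - t *: (q - p)); last by l2_ring.
  rewrite -(ler_pXn2r (n := 2)) ?nnegrE ?l2norm_ge0// !sqr_l2norm.
  move: (x - p) (q - p) => v w; rewrite !ipE_linear (ipC w v).
  by move: (ip v v) (ip v w) (ip w w) => ? ? ?; lra.
move: (ip_ge0 (q - p)); move: (ip (x - p) _) (ip _ _) => a b b0 h.
case: (lerP a 0) => // a0.
have ab0 : 0 < b + a by rewrite ltr_wpDl.
pose t := a / (b + a).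
have tab : t * (b + a) = a by rewrite divfK ?gt_eqF.
have t0 : 0 < t by rewrite divr_gt0.
have t01 : 0 <= t <= 1 by rewrite ltW//= ler_pdivrMr// mul1r lerDr.
have : t * (2 * a) <= t * (t * b) by have := h t t01; lra.
rewrite ler_pM2l//; have : 0 < t * a by rewrite mulr_gt0.
by lra.
Qed.

End convex_projection.

(** * Orthogonal projections and variational inequalities *)

Section orthogonal_projection.
Context d (T : measurableType d) (R : realType) (P : probability T R) (m : nat).
Implicit Types (x y p q : L2 P m) (D S : set (L2 P m)).

Definition l2_subspace S := S 0 /\ forall (a : R) x y, S x -> S y -> S (a *: x + y).

Lemma l2_subspaceZ S a x : l2_subspace S -> S x -> S (a *: x).
Proof. by move=> [S0 SD] Sx; rewrite -[_ *: _]addr0; exact: SD. Qed.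

Lemma l2_subspaceD S x y : l2_subspace S -> S x -> S y -> S (x + y).
Proof. by move=> [S0 SD] Sx Sy; rewrite -[x]scale1r; exact: SD. Qed.

Lemma l2_subspaceN S x : l2_subspace S -> S x -> S (- x).
Proof. by move=> Ss Sx; rewrite -scaleN1r; exact: l2_subspaceZ. Qed.

Lemma l2_subspaceB S x y : l2_subspace S -> S x -> S y -> S (x - y).
Proof. by move=> Ss Sx Sy; apply: l2_subspaceD => //; exact: l2_subspaceN. Qed.

Lemma l2_subspace_convex S : l2_subspace S -> l2_convex S.
Proof. by move=> Ss x y t Sx Sy _; apply: Ss.2 => //; exact: l2_subspaceZ. Qed.

Lemma orthocomplement_subspace S : l2_subspace (orthocomplement S).
Proof.
split=> [x _|a x y Sx Sy z Sz]; first by rewrite ip0r.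
by rewrite ipDr ipZr Sx// Sy// mulr0 addr0.
Qed.

Lemma orthocomplement_closed S : l2_closed (orthocomplement S).
Proof.
move=> u x Su ux y Sy; have := l2_cvg_ip (l2_cvg_cst y) ux.
under eq_fun do rewrite Su//.
by move=> /cvg_lim <- //; rewrite lim_cst.
Qed.

Lemma orth_projP S x : l2_subspace S -> l2_closed S ->
  is_orth_proj S x (orth_proj S x).
Proof.
move=> Ss Sc; suff [p Sp] : exists p, is_orth_proj S x p by exact: (xgetI x Sp).
have projx := metric_projP x (ex_intro _ _ Ss.1) Sc (l2_subspace_convex Ss).
exists (metric_proj S x); move: projx; set p := metric_proj S x => projx.
have [Sp np] := metric_proj_normal_cone (l2_subspace_convex Ss) projx.
split=> // y Sy; apply/eqP; rewrite ipC eq_le.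
have := np _ (l2_subspaceD Ss Sp Sy); rewrite addrAC subrr add0r => ->/=.
have := np _ (l2_subspaceB Ss Sp Sy); rewrite addrAC subrr add0r ipNr.
by rewrite oppr_le0.
Qed.

Lemma is_orth_proj_unique S x p q : l2_subspace S ->
  is_orth_proj S x p -> is_orth_proj S x q -> l2norm (p - q) = 0.
Proof.
move=> Ss [Sp xp] [Sq xq].
suff h : ip (p - q) (p - q) = 0 by rewrite /l2norm h sqrtr0.
have Spq := l2_subspaceB Ss Sp Sq.
have -> : ip (p - q) (p - q) = ip (p - q) (x - q) - ip (p - q) (x - p).
  by rewrite !ipE_linear; lra.
by rewrite xp// xq// subrr.
Qed.

(** The two defining properties of [orth_proj S x], read the other way round. *)
Lemma orth_proj_compl S x : l2_subspace S -> l2_closed S ->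
  is_orth_proj (orthocomplement S) x (x - orth_proj S x).
Proof.
move=> Ss Sc; have [Sp xp] := orth_projP x Ss Sc; split=> // y Sy.
by rewrite opprB addrC subrK ipC Sy.
Qed.

Lemma orth_proj_complE S x : l2_subspace S -> l2_closed S ->
  l2norm (orth_proj (orthocomplement S) x - (x - orth_proj S x)) = 0.
Proof.
move=> Ss Sc; apply: is_orth_proj_unique (orthocomplement_subspace S) _ _.
  by apply: orth_projP; [exact: orthocomplement_subspace|exact: orthocomplement_closed].
exact: orth_proj_compl.
Qed.

End orthogonal_projection.

Section variational_inequality.
Context d (T : measurableType d) (R : realType) (P : probability T R) (m : nat).
Implicit Types (x y p q : L2 P m) (D S : set (L2 P m)).

Lemma normal_cone_nonexpansive D x y p q :
  normal_cone D p (x - p) -> normal_cone D q (y - q) ->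
  l2norm (p - q) <= l2norm (x - y).
Proof.
move=> [Dp np] [Dq nq]; have := np _ Dq; have := nq _ Dp => h1 h2.
have := cauchy_schwarz (x - y) (p - q).
have : l2norm (p - q) * l2norm (p - q) <= ip (x - y) (p - q).
  rewrite -expr2 sqr_l2norm; move: h1 h2; rewrite !ipE_linear (ipC q p).
  by lra.
have := l2norm_ge0 (p - q); rewrite le_eqVlt => /predU1P[<- _ _|pq0 h3 h4].
  exact: l2norm_ge0.
by rewrite -(ler_pM2r pq0); exact: le_trans h4.
Qed.

(** A small step against a strongly monotone Lipschitz operator is a strict
    contraction, so that the projected iteration converges geometrically. *)
Lemma strongly_monotone_VI D (B : L2 P m -> L2 P m) (mu K : R) :
  D !=set0 -> l2_closed D -> l2_convex D -> 0 < mu -> 0 <= K ->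
  (forall x y, mu * ip (x - y) (x - y) <= ip (B x - B y) (x - y)) ->
  (forall x y, l2norm (B x - B y) <= K * l2norm (x - y)) ->
  exists z, normal_cone D z (- B z).
Proof.
move=> D0 Dc Dcv mu0 K0 Bmon Blip.
(* Enlarging the Lipschitz constant makes it dominate [mu]. With half the step
   that minimizes [1 - 2 * g * mu + g ^+ 2 * L ^+ 2], the squared contraction
   factor is bounded by [q2], which is then strictly between 0 and 1. *)
pose L := K + mu; have L0 : 0 < L by rewrite ltr_wpDl.
have muL : mu <= L by rewrite lerDr.
pose g := mu / (2 * L ^+ 2).
have L20 : 0 < L ^+ 2 by rewrite exprn_gt0.
have gL : g * L ^+ 2 = mu / 2.
  by rewrite /g; field; rewrite gt_eqF.
have g0 : 0 < g by rewrite divr_gt0// mulr_gt0.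
pose q2 := 1 - g * mu.
have q21 : q2 < 1 by rewrite /q2 gtrBl mulr_gt0.
have q20 : 0 < q2.
  rewrite /q2 subr_gt0 /g mulrAC ltr_pdivrMr ?mulr_gt0// mul1r.
  have : mu * mu <= L ^+ 2 by rewrite -expr2 ler_pXn2r ?nnegrE ?(ltW mu0) ?(ltW L0).
  lra.
have KL : K <= L by rewrite lerDl ltW.
clearbody g L.
pose q := Num.sqrt q2.
have q0 : 0 < q by rewrite sqrtr_gt0.
have q1 : q < 1 by rewrite -[ltRHS]sqrtr1 ltr_sqrt.
pose G x := metric_proj D (x - g *: B x).
have GP x : normal_cone D (G x) (x - g *: B x - G x).
  by apply: metric_proj_normal_cone => //; exact: metric_projP.
have Gq x y : l2norm (G x - G y) <= q * l2norm (x - y).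
  apply: le_trans (normal_cone_nonexpansive (GP x) (GP y)) _.
  apply: ler_l2norm; first by rewrite mulr_ge0 ?l2norm_ge0 ?(ltW q0).
  rewrite exprMn sqr_sqrtr ?(ltW q20)// sqr_l2norm.
  rewrite (_ : _ - _ = (x - y) - g *: (B x - B y)); last first.
    by rewrite scalerBr !opprD !opprK addrACA.
  have h1 := Bmon x y.
  have h2 : ip (B x - B y) (B x - B y) <= L ^+ 2 * ip (x - y) (x - y).
    rewrite -!sqr_l2norm -exprMn ler_pXn2r ?nnegrE ?mulr_ge0 ?l2norm_ge0 ?(ltW L0)//.
    by apply: le_trans (Blip x y) _; rewrite ler_wpM2r ?l2norm_ge0.
  move: h1 h2; move: (x - y) (B x - B y) => v w h1 h2.
  have h3 : g ^+ 2 * ip w w <= g * (mu / 2) * ip v v.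
    rewrite -gL (_ : _ * ip v v = g ^+ 2 * (L ^+ 2 * ip v v)).
      by rewrite ler_pM2l ?exprn_gt0.
    by move: (ip v v) => s; ring.
  have h4 : g * (mu * ip v v) <= g * ip w v by rewrite ler_pM2l.
  have h5 : 0 <= g * mu * ip v v by apply: mulr_ge0; [apply: mulr_ge0;
      exact: ltW|exact: ip_ge0].
  by rewrite /q2 !ipE_linear (ipC v w); lra.
have [x0 _] := D0; pose z k := iter k G x0.
pose c := l2norm (z 1%N - z 0%N) + 1.
have c0 : 0 < c by rewrite ltr_wpDl ?l2norm_ge0.
have zq k : l2norm (z k.+1 - z k) <= c * q ^+ k.
  elim: k => [|k ih]; first by rewrite mulr1 lerDl.
  by apply: le_trans (Gq _ _) _; rewrite exprS mulrCA ler_pM2l.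
have q01 : 0 < q < 1 by rewrite q0.
have [f [zf _]] := geometric_cauchy_cvg c0 q01 zq.
have {}zf : l2_cvg z f.
  apply: l2_cvg_le zf _; apply: cvg_geometric.
  by rewrite ger0_norm// ltW.
have zG : l2_cvg (fun k => z k.+1) (G f).
  exact: (l2_cvg_lipschitz Gq zf).
have zf1 : l2_cvg (fun k => z k.+1) f.
  apply/l2_cvgP => e /((l2_cvgP _ _).1 zf)[k0 zk0].
  by exists k0 => k kk; exact/zk0/leqW.
(* The fixed point is reached up to a null set, which the inner product does
   not see. *)
have Gf0 : l2norm (f - G f) = 0 := l2_cvg_unique zf1 zG.
have BGf0 : l2norm (B (G f) - B f) = 0.
  apply/eqP; rewrite eq_le l2norm_ge0 andbT.
  by apply: le_trans (Blip _ _) _; rewrite l2distC Gf0 mulr0.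
exists (G f); have [DGf nGf] := GP f; split=> // y Dy.
have := nGf _ Dy.
have -> : f - g *: B f - G f = (f - G f) + g *: (B (G f) - B f) + g *: (- B (G f)).
  by rewrite scalerBr scalerN addrAC -!addrA; congr (_ + (_ + _));
      rewrite addrCA subrr addr0.
by rewrite ipDl ipDl !(ipZl g) (ip_null _ Gf0) (ip_null _ BGf0) mulr0 !add0r pmulr_rle0.
Qed.

End variational_inequality.

(** * Recursions of real sequences *)

Section real_sequences.
Context (R : realType).
Implicit Types (a s alpha delta : nat -> R).

Lemma sum_nat_split f K n : \sum_(0 <= k < K + n) f k =
  \sum_(0 <= k < K) f k + \sum_(0 <= k < n) f (K + k)%N :> R.
Proof.
elim: n => [|n ih]; first by rewrite addn0 [X in _ + X]big_geq// addr0.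
by rewrite addnS !big_nat_recr//= ih addrA.
Qed.

Lemma bounded_sum_tail delta (D : R) : (forall k, 0 <= delta k) ->
  (forall n, \sum_(0 <= k < n) delta k <= D) ->
  forall e, 0 < e -> exists K, forall n, \sum_(0 <= k < n) delta (K + k)%N <= e.
Proof.
move=> d0 dD e e0.
pose E := range (fun n => \sum_(0 <= k < n) delta k).
have supE : has_sup E.
  split; first by exists 0, 0%N => //; rewrite big_geq.
  by exists D => _ [n _ <-]; exact: dD.
have [_ [K _ <-] Ke] := sup_adherent e0 supE.
exists K => n.
have : \sum_(0 <= k < K + n) delta k <= sup E by apply: ub_le_sup supE.2 _ _;
    exists (K + n)%N.
by rewrite sum_nat_split; move: Ke; lra.
Qed.

(** The elementary bound [1 - t <= 1 / (1 + t)], iterated; it makes a divergent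
    sum of the [alpha k] force the product to vanish. *)
Lemma prod_1B_le alpha n : (forall k, 0 < alpha k < 1) ->
  (\prod_(0 <= k < n) (1 - alpha k)) * (1 + \sum_(0 <= k < n) alpha k) <= 1.
Proof.
move=> a01; elim: n => [|n ih]; first by rewrite !big_geq// addr0 mulr1.
rewrite !big_nat_recr//=; apply: le_trans ih.
have p0 : 0 <= \prod_(0 <= k < n) (1 - alpha k).
  by apply: prodr_ge0 => k _; have /andP[_ /ltW] := a01 k; rewrite subr_ge0.
rewrite -mulrA ler_wpM2l//.
have s0 : 0 <= \sum_(0 <= k < n) alpha k.
  by apply: sumr_ge0 => k _; have /andP[/ltW] := a01 k.
have /andP[an0 _] := a01 n.
have : 0 <= alpha n * \sum_(0 <= k < n) alpha k by rewrite mulr_ge0// ltW.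
have : 0 <= alpha n * alpha n by rewrite mulr_ge0// ltW.
by lra.
Qed.

(** After a rank beyond which the tail of [delta] is below [e / 2], the excess of
    [s] over [eta] is multiplied by the product of the [1 - alpha k], which tends
    to zero. *)
Lemma averaged_recursion s alpha delta (D eta : R) :
  (forall k, 0 <= s k) -> (forall k, 0 < alpha k < 1) ->
  (forall M, exists n, M <= \sum_(0 <= k < n) alpha k) ->
  (forall k, 0 <= delta k) -> (forall n, \sum_(0 <= k < n) delta k <= D) ->
  0 <= eta ->
  (exists K, forall k, (K <= k)%N ->
     s k.+1 <= (1 - alpha k) * s k + alpha k * eta + delta k) ->
  forall e, 0 < e -> exists K, forall k, (K <= k)%N -> s k <= eta + e.
Proof.
move=> s0 a01 asum d0 dD eta0 [K0 srec] e e0.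
have e20 : 0 < e / 2 by rewrite divr_gt0.
have [K1 dK1] := bounded_sum_tail d0 dD e20.
pose K := (K1 + K0)%N.
have dK n : \sum_(0 <= k < n) delta (K + k)%N <= e / 2.
  apply: le_trans (dK1 (K0 + n)%N); rewrite sum_nat_split -[leLHS]add0r lerD//.
    by apply: sumr_ge0 => k _.
  by apply: ler_sum => k _; rewrite addnA.
pose a' k := alpha (K + k)%N.
have a'01 k : 0 < a' k < 1 by exact: a01.
have a'sum M : exists n, M <= \sum_(0 <= k < n) a' k.
  have [n nM] := asum (M + \sum_(0 <= k < K) alpha k).
  exists n; move: nM.
  have : \sum_(0 <= k < n) alpha k <= \sum_(0 <= k < n + K) alpha k.
    rewrite sum_nat_split lerDl.
    by apply: sumr_ge0 => k _; have /andP[/ltW] := a01 (n + k)%N.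
  by rewrite addnC sum_nat_split -/a'; lra.
have p01 k : 0 <= 1 - a' k <= 1.
  by have /andP[/ltW h1 /ltW h2] := a'01 k; apply/andP; split; lra.
have step n : s (K + n)%N <= eta + (\prod_(0 <= k < n) (1 - a' k)) * s K
    + \sum_(0 <= k < n) delta (K + k)%N.
  elim: n => [|n ih]; first by rewrite !big_geq// addn0 mul1r addr0 lerDr.
  rewrite addnS !big_nat_recr//=.
  have K0Kn : (K0 <= K + n)%N by rewrite -addnA addnCA leq_addr.
  apply: le_trans (srec _ K0Kn) _; rewrite -/(a' n).
  have /andP[p0 p1] := p01 n.
  have S0 : 0 <= \sum_(0 <= k < n) delta (K + k)%N by apply: sumr_ge0 => k _.
  move: (ler_wpM2l p0 ih) (ler_wpM2r S0 p1).
  set S := \sum_(0 <= k < n) delta _; set p := \prod_(_ <= _ < _) _.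
  by lra.
have [n0 n0P] := a'sum (2 * s K / e).
exists (K + n0)%N => k Kk; pose n := (k - K)%N.
have nk : (K + n)%N = k by rewrite subnKC// (leq_trans (leq_addr _ _) Kk).
have n0n : (n0 <= n)%N by rewrite leq_subRL ?(leq_trans (leq_addr n0 K) Kk).
rewrite -nk; apply: le_trans (step n) _.
have : \sum_(0 <= k < n0) a' k <= \sum_(0 <= k < n) a' k.
  rewrite -(subnKC n0n) sum_nat_split lerDl.
  by apply: sumr_ge0 => i _; have /andP[/ltW] := a'01 (n0 + i)%N.
have := prod_1B_le n a'01.
have : 0 <= \prod_(0 <= k < n) (1 - a' k).
  by apply: prodr_ge0 => i _; have /andP[] := p01 i.
set p := \prod_(_ <= _ < _) _; set A := \sum_(0 <= k < n) a' k => p0 pA n0A.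
have {}n0A : 2 * s K / e <= A by exact: le_trans n0A.
have {}n0A : 2 * s K <= A * e by rewrite -ler_pdivrMr.
have ps : p * s K <= e / 2.
  have := ler_wpM2l p0 n0A; have : p * A * e <= 1 * e
      by rewrite ler_wpM2r ?(ltW e0)//; lra.
  by lra.
by have := dK n; lra.
Qed.

Lemma bounded_recursion (w eta alpha : nat -> R) (H : R) :
  (forall k, 0 < alpha k < 1) -> (forall k, 0 <= eta k) ->
  (forall n, \sum_(0 <= k < n) eta k <= H) ->
  (forall k, w k.+1 <= alpha k * w 0%N + (1 - alpha k) * (w k + 2 * eta k)) ->
  forall k, w k <= w 0%N + 2 * H.
Proof.
move=> a01 eta0 sumH wS k.
suff : w k <= w 0%N + 2 * \sum_(0 <= i < k) eta i.
  by move=> /le_trans; apply; rewrite lerD2l ler_pM2l// sumH.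
elim: k => [|k ih]; first by rewrite big_geq// mulr0 addr0.
rewrite big_nat_recr//=; apply: le_trans (wS k) _.
have /andP[ak0 ak1] := a01 k; have ak1' : 0 <= 1 - alpha k by lra.
have := ler_wpM2l ak1' ih.
have s0 : 0 <= \sum_(0 <= i < k) eta i by apply: sumr_ge0 => i _; exact: eta0.
have := mulr_ge0 (ltW ak0) s0; have := mulr_ge0 (ltW ak0) (eta0 k).
by lra.
Qed.

End real_sequences.

(** * The Halpern proximal point iteration *)

Section halpern.
Context d (T : measurableType d) (R : realType) (P : probability T R) (m : nat).
Implicit Types (u v p q x y z : L2 P m) (A : L2 P m -> L2 P m -> Prop).

Definition monotone_graph A := forall p v p' v', A p v -> A p' v' ->
  0 <= ip (p - p') (v - v').

Definition closed_graph A := forall (p v : nat -> L2 P m) p' v',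
  (forall k, A (p k) (v k)) -> l2_cvg p p' -> l2_cvg v v' -> A p' v'.

(** Along the resolvents of [A] at [u0] with vanishing weight, the squared
    distance to [u0] is nondecreasing and bounded by its value at any zero, and
    monotonicity bounds the squared distance between two resolvents
    by the increment of that quantity. *)
Lemma resolvent_path_cvg A u0 z : monotone_graph A -> closed_graph A -> A z 0 ->
  (forall t, 0 < t <= 1 -> exists p, A p (t *: (u0 - p))) ->
  exists (p : nat -> L2 P m) us,
    [/\ forall n, A (p n) (n.+1%:R^-1 *: (u0 - p n)), l2_cvg p us & A us 0].
Proof.
move=> Am Ac Az Ares.
pose t n : R := n.+1%:R^-1.
have t0 n : 0 < t n by rewrite invr_gt0.
have t1 n : t n <= 1 by rewrite invf_le1// ler1n.
have /choice[p pA] : forall n, exists p, A p (t n *: (u0 - p)).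
  by move=> n; apply: Ares; rewrite t0 t1.
pose a n := u0 - p n; pose N n := ip (a n) (a n).
have NB n : N n <= ip (u0 - z) (u0 - z).
  have := Am _ _ _ _ (pA n) Az; rewrite subr0 ipZr pmulr_rge0// -/(a n) => h.
  have -> : u0 - z = (p n - z) + a n by rewrite [RHS]addrC /a subrKA.
  have := ip_ge0 (p n - z); rewrite /N.
  move: (a n) (p n - z) h => b c h.
  by rewrite !ipE_linear (ipC b c); lra.
have aN i j : (i <= j)%N -> ip (a i - a j) (a i - a j) <= N j - N i.
  rewrite leq_eqVlt => /predU1P[->|ij]; first by rewrite !subrr ip0l.
  have := Am _ _ _ _ (pA j) (pA i); rewrite -/(a i) -/(a j).
  have -> : p j - p i = a i - a j by rewrite /a opprB [RHS]addrC subrKA.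
  have tij : t j < t i by rewrite ltf_pV2 ?posrE// ltr_nat.
  rewrite /N; have := ip_ge0 (a i - a j); move: (a i) (a j) => b c.
  rewrite !ipE_linear (ipC c b).
  have := t0 j; have := t0 i; move: (t i) (t j) tij => s r rs s0 r0.
  set x := ip b b; set y := ip c c; set w := ip b c.
  move=> xy mon.
  have h : (s + r) * (x + y - 2 * w) <= (s - r) * (y - x) by lra.
  have yx : 0 <= y - x.
    rewrite -(pmulr_rge0 _ (_ : 0 < s - r)) ?subr_gt0//.
    by apply: le_trans h; rewrite mulr_ge0//; lra.
  rewrite -(ler_pM2l (_ : 0 < s + r)); last by lra.
  have : 0 <= r * (y - x) by rewrite mulr_ge0// ltW.
  by lra.
have Nmono i j : (i <= j)%N -> N i <= N j.
  by move=> /aN; have := ip_ge0 (a i - a j); lra.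
pose E := range N.
have supE : has_sup E.
  by split; [exists (N 0%N), 0%N|exists (ip (u0 - z) (u0 - z)) => _ [n _ <-]].
have pC e : 0 < e -> exists K, forall i j, (K <= i)%N -> (K <= j)%N ->
    l2norm (p i - p j) < e.
  move=> e0; have e20 : 0 < e ^+ 2 by rewrite exprn_gt0.
  have [_ [K _ <-] KN] := sup_adherent e20 supE.
  have main i j : (K <= i)%N -> (i <= j)%N -> l2norm (p i - p j) < e.
    move=> Ki ij; rewrite -(ltr_pXn2r (n := 2)) ?nnegrE ?l2norm_ge0 ?(ltW e0)//.
    have -> : p i - p j = a j - a i by rewrite /a opprB [RHS]addrC subrKA.
    rewrite l2distC sqr_l2norm; have := aN _ _ ij; have := Nmono _ _ Ki.
    have : N j <= sup E by apply: ub_le_sup supE.2 _ _; exists j.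
    by lra.
  exists K => i j Ki Kj; case: (leqP i j) => [ij|/ltnW ji]; first exact: main.
  by rewrite l2distC; exact: main.
have [us [_ [pus _]]] := l2_cauchy_cvg pC.
exists p, us; split=> //; apply: Ac pA pus _.
pose B := ip (u0 - z) (u0 - z) + 1.
apply: (l2_cvg_le (b := fun n => t n * B)) => [n|].
  rewrite subr0 l2normZ gtr0_norm// ler_wpM2l ?(ltW (t0 n))//.
  apply: ler_l2norm; first by rewrite addr_ge0 ?ip_ge0.
  have b0 := ip_ge0 (u0 - z); apply: le_trans (NB n) _; rewrite /B.
  by move: b0; set b := ip _ _ => b0; have := sqr_ge0 b; rewrite sqrrD; lra.
rewrite -[0](mul0r B); apply: cvgM; last exact: cvg_cst.
exact: cvg_harmonic.
Qed.

(** One relaxed resolvent step. With [x] the displacement of the perturbed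
    input from a zero and [y] its displacement from the output, [ip (x - y) y]
    is the monotonicity of the operator between the output and the zero. *)
Lemma relaxed_step_le x y e (b : R) : 0 <= ip (x - y) y -> 0 <= b <= 2 ->
  l2norm (x - b *: y + (1 - b) *: e) ^+ 2 <=
  l2norm x ^+ 2 - b * (2 - b) * l2norm y ^+ 2
    + 2 * (l2norm x * l2norm e) + l2norm e ^+ 2.
Proof.
move=> xy /andP[b0 b2].
have h : l2norm (x - b *: y) ^+ 2 <= l2norm x ^+ 2 - b * (2 - b) * l2norm y ^+ 2.
  have := mulr_ge0 b0 xy.
  by rewrite !sqr_l2norm !ipE_linear (ipC y x); lra.
have hx : l2norm (x - b *: y) <= l2norm x.
  rewrite -(ler_pXn2r (n := 2)) ?nnegrE ?l2norm_ge0//.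
  have : 0 <= b * (2 - b) * l2norm y ^+ 2
      by rewrite mulr_ge0 ?sqr_ge0// mulr_ge0// subr_ge0.
  by lra.
have he : l2norm ((1 - b) *: e) <= l2norm e.
  rewrite l2normZ -[leRHS]mul1r ler_wpM2r ?l2norm_ge0// ler_norml.
  by apply/andP; split; lra.
have := ler_l2normD (x - b *: y) ((1 - b) *: e).
move: (l2norm_ge0 (x - b *: y)) (l2norm_ge0 ((1 - b) *: e)).
move: (l2norm_ge0 (x - b *: y + (1 - b) *: e)).
move: (l2norm_ge0 x) (l2norm_ge0 e).
move: h hx he; set X := l2norm (x - _); set E := l2norm (_ *: e).
set S := l2norm (_ + _) => h hx he x0 e0 S0 X0 E0 SXE.
have : S ^+ 2 <= (X + E) ^+ 2 by rewrite ler_pXn2r ?nnegrE ?addr_ge0.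
have : X * E <= l2norm x * l2norm e by rewrite ler_pM.
have : E ^+ 2 <= l2norm e ^+ 2 by rewrite ler_pXn2r ?nnegrE.
by rewrite sqrrD; lra.
Qed.

Lemma relaxed_step_norm_le x y e (b : R) : 0 <= ip (x - y) y -> 0 <= b <= 2 ->
  l2norm (x - b *: y + (1 - b) *: e) <= l2norm x + l2norm e.
Proof.
move=> xy b02; apply: ler_l2norm; first by rewrite addr_ge0 ?l2norm_ge0.
rewrite -sqr_l2norm; apply: le_trans (relaxed_step_le e xy b02) _.
have /andP[b0 b2] := b02.
have : 0 <= b * (2 - b) * l2norm y ^+ 2
    by rewrite mulr_ge0 ?sqr_ge0// mulr_ge0// subr_ge0.
by rewrite sqrrD; lra.
Qed.

End halpern.

Section halpern_step.
Context d (T : measurableType d) (R : realType) (P : probability T R) (m : nat).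
Implicit Types (u p v x y z e q : L2 P m).

(** The inequality behind Halpern iterations: anchoring at [x] contracts the
    squared norm at the price of an inner product with the anchor. *)
Lemma sqr_convex_le x y (a : R) : 0 <= a <= 1 ->
  l2norm (a *: x + (1 - a) *: y) ^+ 2 <=
  (1 - a) * l2norm y ^+ 2 + 2 * a * ip x (a *: x + (1 - a) *: y).
Proof.
move=> /andP[a0 a1]; rewrite !sqr_l2norm !ipE_linear (ipC y x).
have := ip_ge0 x; have := ip_ge0 y; set X := ip x x; set Y := ip y y => Y0 X0.
have : 0 <= a ^+ 2 * X by rewrite mulr_ge0 ?sqr_ge0.
have : 0 <= a * (1 - a) * Y by rewrite mulr_ge0// mulr_ge0// subr_ge0.
by lra.
Qed.

Lemma ip_norm_le x y : 0 <= ip (x - y) y ->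
  l2norm y <= l2norm x /\ l2norm (x - y) <= l2norm x.
Proof.
move=> xy; have x2 : l2norm x ^+ 2 = ip (x - y) (x - y) + 2 * ip (x - y) y + ip y y.
  by rewrite sqr_l2norm !ipE_linear (ipC y x); lra.
split; apply: ler_l2norm; rewrite ?l2norm_ge0// x2.
  by have := ip_ge0 (x - y); lra.
by have := ip_ge0 y; lra.
Qed.

Lemma norm_1B_le1 (c : R) : 0 <= c <= 2 -> `|1 - c| <= 1.
Proof. by move=> /andP[c0 c2]; rewrite ler_norml; apply/andP; split; lra. Qed.

Section step.
Variables (u0 u uh e q us u' : L2 P m) (a b : R).
Hypotheses (a01 : 0 < a < 1) (b02 : 0 < b < 2).
Hypothesis qus : 0 <= ip (q - us) (uh - e - q).
Hypothesis u'E : u' = a *: u0 + (1 - a) *: ((1 - b) *: uh + b *: q).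

Let eta := l2norm (uh - u) + l2norm e.

Let input_norm_le : l2norm (uh - e - us) <= l2norm (u - us) + eta.
Proof.
have -> : uh - e - us = (u - us) + ((uh - u) - e) by l2_ring.
by apply: le_trans (ler_l2normD _ _) _; rewrite lerD2l; exact: ler_l2normB.
Qed.

Let step_ip : 0 <= ip (uh - e - us - (uh - e - q)) (uh - e - q).
Proof. by rewrite (_ : _ - _ = q - us)//; l2_ring. Qed.

Let b02' : 0 <= b <= 2.
Proof. by have /andP[/ltW -> /ltW ->] := b02. Qed.

Let u'usE : u' - us = a *: (u0 - us) +
  (1 - a) *: (uh - e - us - b *: (uh - e - q) + (1 - b) *: e).
Proof. by rewrite u'E; l2_ring. Qed.

Lemma halpern_step_norm_le : l2norm (u' - us) <=
  a * l2norm (u0 - us) + (1 - a) * (l2norm (u - us) + 2 * (l2norm (uh - u) + l2norm e)).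
Proof.
have /andP[a0 a1] := a01; have a1' : 0 < 1 - a by rewrite subr_gt0.
rewrite u'usE; apply: le_trans (ler_l2normD _ _) _.
rewrite !l2normZ !gtr0_norm// lerD2l ler_pM2l//.
apply: le_trans (relaxed_step_norm_le e step_ip b02') _.
apply: le_trans (lerD input_norm_le (lexx _)) _.
rewrite /eta; move: (l2norm_ge0 (uh - u)).
by move: (l2norm (u - us)) (l2norm (uh - u)) (l2norm e) => ? ? ? ?; lra.
Qed.

(** Unlike [halpern_step_norm_le], which only serves to bound the iterates, this
    estimate keeps the quadratic decrease in the displacement of the step. *)
Lemma halpern_step_sqr_le (M H : R) :
  l2norm (u - us) <= M -> l2norm (uh - u) + l2norm e <= H ->
  l2norm (u' - us) ^+ 2 <= (1 - a) * (l2norm (u - us) ^+ 2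
      - b * (2 - b) * l2norm (uh - e - q) ^+ 2
      + 4 * (M + H) * (l2norm (uh - u) + l2norm e))
    + 2 * a * ip (u0 - us) (u' - us).
Proof.
move=> uM eH; have /andP[a0 a1] := a01; have a1' : 0 < 1 - a by rewrite subr_gt0.
have a01' : 0 <= a <= 1 by rewrite !ltW.
rewrite u'usE; apply: le_trans (sqr_convex_le _ _ a01') _.
rewrite lerD2r ler_pM2l//.
apply: le_trans (relaxed_step_le e step_ip b02') _.
move: (l2norm_ge0 (uh - e - us)) (l2norm_ge0 (u - us)) (l2norm_ge0 (uh - u)).
move: (l2norm_ge0 e) input_norm_le uM eH; rewrite /eta.
move: (l2norm (uh - e - us)) (l2norm (u - us)) (l2norm (uh - u)) (l2norm e).
move: (l2norm (uh - e - q)) => Y X W h E E0 XW WM hEH X0 W0 h0.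
have hE0 : 0 <= h + E by rewrite addr_ge0.
have : X ^+ 2 <= (W + (h + E)) ^+ 2 by rewrite ler_pXn2r ?nnegrE ?addr_ge0.
have h1 : W * (h + E) <= M * (h + E) by rewrite ler_wpM2r.
have h2 : (h + E) * (h + E) <= H * (h + E) by rewrite ler_wpM2r.
have h3 : X * E <= (M + H) * (h + E) by apply: ler_pM => //; lra.
have h4 : E ^+ 2 <= H * (h + E) by rewrite expr2; apply: ler_pM => //; lra.
by rewrite sqrrD; lra.
Qed.

(** The demiclosedness argument, made quantitative. Testing the monotonicity of
    the operator between the output and a point [p] of the resolvent path bounds
    [ip (u0 - p) (q - p)] by the displacement of the step, and [p] is close to
    the limit [us] of the path. *)
Lemma halpern_step_ip_le (p : L2 P m) (t M H Q : R) :
  0 < t -> 0 <= ip (q - p) (uh - e - q - t *: (u0 - p)) ->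
  l2norm (p - us) <= 1 -> l2norm (u0 - us) <= M -> l2norm (u' - us) <= M ->
  l2norm (u - us) <= M -> l2norm (uh - u) + l2norm e <= H ->
  M + H + 1 <= Q -> M + (M + H) <= Q ->
  ip (u0 - us) (u' - us) <= Q * (t^-1 + 1) * l2norm (uh - e - q) + Q * l2norm e
    + a * Q ^+ 2 + 2 * Q * l2norm (p - us).
Proof.
move=> t0 qp pus u0M u'M uM eH Q1 Q2; have /andP[a0 a1] := a01.
have /andP[b0 b2] := b02.
have [_] := ip_norm_le step_ip.
rewrite (_ : _ - (uh - e - q) = q - us); last by l2_ring.
move=> qx; have qusMH : l2norm (q - us) <= M + H.
  apply: le_trans qx _; apply: le_trans input_norm_le _; exact: lerD.
have M0 : 0 <= M := le_trans (l2norm_ge0 _) uM.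
have hE0 : 0 <= H by apply: le_trans eH; rewrite addr_ge0 ?l2norm_ge0.
have Q3 : M + 1 <= Q by apply: le_trans Q1; rewrite lerD2r lerDl.
have Q4 : M <= Q by apply: le_trans Q3; rewrite lerDl.
have Q0 : 0 <= Q := le_trans M0 Q4.
have qpQ : l2norm (q - p) <= Q.
  apply: le_trans (ler_l2dist us q p) _; rewrite (l2distC us p).
  exact: le_trans (lerD qusMH pus) Q1.
have u0qQ : l2norm (u0 - q) <= Q.
  apply: le_trans (ler_l2dist us u0 q) _; rewrite (l2distC us q).
  exact: le_trans (lerD u0M qusMH) Q2.
have u0pQ : l2norm (u0 - p) <= Q.
  apply: le_trans (ler_l2dist us u0 p) _; rewrite (l2distC us p).
  exact: le_trans (lerD u0M pus) Q3.
have u'Q : l2norm (u' - us) <= Q := le_trans u'M Q4.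
move: qp; set y := uh - e - q => qp.
have u'q : l2norm (u' - q) <= a * Q + l2norm y + l2norm e.
  have -> : u' - q = a *: (u0 - q) + ((1 - a) * (1 - b)) *: (y + e).
    by rewrite u'E /y; l2_ring.
  apply: le_trans (ler_l2normD _ _) _; rewrite !l2normZ gtr0_norm// -[leRHS]addrA.
  apply: lerD; first by rewrite ler_pM2l.
  apply: le_trans (ler_l2normD y e); rewrite -[leRHS]mul1r ler_wpM2r ?l2norm_ge0//.
  rewrite normrM -[leRHS]mulr1 ler_pM// norm_1B_le1 ?b02'//.
  by rewrite (ltW a0) (le_trans (ltW a1))// ler1n.
have -> : ip (u0 - us) (u' - us) = ip (u0 - p) (q - p) + ip (u0 - p) (u' - q)
    + ip (u0 - p) (p - us) + ip (p - us) (u' - us).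
  rewrite -!ipDr (_ : q - p + (u' - q) + (p - us) = u' - us); last by l2_ring.
  by rewrite -ipDl; congr ip; l2_ring.
have i1 : ip (u0 - p) (q - p) <= Q * t^-1 * l2norm y.
  rewrite -(ler_pM2l t0).
  have -> : t * (Q * t^-1 * l2norm y) = Q * l2norm y.
    by rewrite mulrA mulrCA divff ?gt_eqF// mulr1.
  apply: (@le_trans _ _ (l2norm (q - p) * l2norm y)).
    apply: le_trans (cauchy_schwarz (q - p) y).
    by move: qp; rewrite ipDr ipNr ipZr (ipC (q - p) (u0 - p)) subr_ge0.
  by apply: ler_wpM2r; [exact: l2norm_ge0|exact: qpQ].
have i2 : ip (u0 - p) (u' - q) <= Q * (a * Q + l2norm y + l2norm e).
  apply: le_trans (cauchy_schwarz _ _) _.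
  by apply: ler_pM; [exact: l2norm_ge0|exact: l2norm_ge0|exact: u0pQ|exact: u'q].
have i3 : ip (u0 - p) (p - us) <= Q * l2norm (p - us).
  apply: le_trans (cauchy_schwarz _ _) _.
  by apply: ler_wpM2r; [exact: l2norm_ge0|exact: u0pQ].
have i4 : ip (p - us) (u' - us) <= l2norm (p - us) * Q.
  apply: le_trans (cauchy_schwarz _ _) _.
  by apply: ler_wpM2l; [exact: l2norm_ge0|exact: u'Q].
apply: le_trans (lerD (lerD (lerD i1 i2) i3) i4) _.
clear qp pus u0M u'M uM eH qx qusMH qpQ u0qQ u0pQ u'Q u'q i1 i2 i3 i4.
by move: (l2norm y) (l2norm e) (l2norm (p - us)) => ? ? ?; lra.
Qed.

End step.
End halpern_step.

Section halpern.
Context d (T : measurableType d) (R : realType) (P : probability T R) (m : nat).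
Implicit Types (p v x y z : L2 P m) (A : L2 P m -> L2 P m -> Prop).

(** Completing the square: the term that is linear in the displacement [Y] of
    the step is absorbed by the quadratic decrease, at a cost of order
    [a ^+ 2]. *)
Lemma absorb_linear (a c bb W Y E eta h Q D I rho : R) :
  0 < a <= 2^-1 -> 0 < c -> c <= bb -> 0 <= eta -> 0 <= E <= eta -> 0 <= h ->
  0 <= Q ->
  I <= Q * D * Y + Q * E + a * Q ^+ 2 + 2 * Q * rho ->
  (1 - a) * (W - bb * Y ^+ 2 + h * eta) + 2 * a * I <=
  (1 - a) * W + a * (4 * Q * rho + a * (2 * Q ^+ 2 + 2 * (Q * D) ^+ 2 / c))
    + (h + 2 * Q) * eta.
Proof.
move=> /andP[a0 a2] c0 cb eta0 /andP[E0 Eeta] h0 Q0 HI.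
have a1 : 0 < 1 - a by lra.
set K := Q * D.
have cK : c * (K ^+ 2 / c) = K ^+ 2 by rewrite mulrC divfK ?gt_eqF.
have Y2 : 0 <= Y ^+ 2 by exact: sqr_ge0.
have h1 : (c / 2) * Y ^+ 2 <= (1 - a) * (bb * Y ^+ 2).
  rewrite [leRHS]mulrA ler_wpM2r//.
  have : 2^-1 * bb <= (1 - a) * bb by rewrite ler_wpM2r//; lra.
  by lra.
have h2 : 2 * (a * (K * Y)) <= (c / 2) * Y ^+ 2 + 2 * a ^+ 2 * (K ^+ 2 / c).
  have s0 : 0 <= c * (Y - 2 * a * (K / c)) ^+ 2 by rewrite mulr_ge0 ?sqr_ge0 ?(ltW c0).
  have e1 : c * (Y - 2 * a * (K / c)) ^+ 2 =
      c * Y ^+ 2 - 4 * (a * (K * Y)) + 4 * a ^+ 2 * (K ^+ 2 / c).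
    by field; rewrite gt_eqF.
  by lra.
have h3 : (1 - a) * (h * eta) <= h * eta.
  have : 0 <= a * (h * eta) by rewrite mulr_ge0 ?(ltW a0)// mulr_ge0.
  by lra.
have h4 : 2 * a * (Q * E) <= 2 * Q * eta.
  have : a * (Q * E) <= 1 * (Q * eta).
    by apply: ler_pM; rewrite ?(ltW a0) ?mulr_ge0// ?ler_wpM2l//; lra.
  by lra.
have := ler_wpM2l (ltW a0) HI; rewrite -/K.
by lra.
Qed.

(** The outputs [q k] need only be monotonically related to the graph of [A]:
    an update that is known almost everywhere determines them up to a null
    element only. *)
Theorem halpern_proximal_cvg A (u uh q e : nat -> L2 P m)
    (alpha beta : nat -> R) (H c : R) (K0 : nat) z :
  monotone_graph A -> closed_graph A -> A z 0 ->
  (forall w t, 0 < t <= 1 -> exists p, A p (t *: (w - p))) ->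
  (forall k, 0 < alpha k < 1) -> alpha @ \oo --> (0 : R) ->
  (forall M, exists n, M <= \sum_(0 <= k < n) alpha k) ->
  (forall k, 0 < beta k < 2) ->
  0 < c -> (forall k, (K0 <= k)%N -> c <= beta k * (2 - beta k)) ->
  (forall n, \sum_(0 <= k < n) (l2norm (uh k - u k) + l2norm (e k)) <= H) ->
  (forall k p v, A p v -> 0 <= ip (q k - p) (uh k - e k - q k - v)) ->
  (forall k, u k.+1 = alpha k *: u 0%N
     + (1 - alpha k) *: ((1 - beta k) *: uh k + beta k *: q k)) ->
  exists us, A us 0 /\ l2_cvg u us.
Proof.
move=> Am Ac Az Ares a01 a_0 a_sum b02 c0 bc sumH qA uS.
have [p [us [pA pus Aus]]] := resolvent_path_cvg Am Ac Az (Ares (u 0%N)).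
exists us; split; first exact: Aus.
have [eta etaE] : {eta | forall k, eta k = l2norm (uh k - u k) + l2norm (e k)}.
  by exists (fun k => l2norm (uh k - u k) + l2norm (e k)).
have [w wE] : {w | forall k, w k = l2norm (u k - us)}.
  by exists (fun k => l2norm (u k - us)).
have [rho rhoE] : {rho | forall n, rho n = l2norm (p n - us)}.
  by exists (fun n => l2norm (p n - us)) => n; exact: erefl.
have sum_eta n : \sum_(0 <= k < n) eta k <= H.
  by under eq_bigr do rewrite etaE; exact: sumH.
have eta0 k : 0 <= eta k by rewrite etaE addr_ge0 ?l2norm_ge0.
have H0 : 0 <= H by have := sum_eta 0%N; rewrite big_geq.
have etaH k : eta k <= H.
  apply: le_trans (sum_eta k.+1); rewrite big_nat_recr//= lerDr.
  by apply: sumr_ge0 => i _; exact: eta0.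
have w0 k : 0 <= w k by rewrite wE l2norm_ge0.
have qus k : 0 <= ip (q k - us) (uh k - e k - q k).
  by have := qA k _ _ Aus; rewrite subr0.
have wS k : w k.+1 <= alpha k * w 0%N + (1 - alpha k) * (w k + 2 * eta k).
  by rewrite !wE etaE; exact: halpern_step_norm_le (a01 k) (b02 k) (qus k) (uS k).
have wM := bounded_recursion a01 eta0 sum_eta wS.
move: wM; set M := w 0%N + 2 * H => wM.
have M0 : 0 <= M := le_trans (w0 0%N) (wM 0%N).
pose Q := 2 * M + H + 1.
have Q0 : 0 < Q by rewrite /Q; lra.
pose delta k := (4 * (M + H) + 2 * Q) * eta k.
have recur n k : (K0 <= k)%N -> alpha k <= 2^-1 -> rho n <= 1 ->
  w k.+1 ^+ 2 <= (1 - alpha k) * w k ^+ 2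
    + alpha k * (4 * Q * rho n
       + alpha k * (2 * Q ^+ 2 + 2 * (Q * (n.+1%:R + 1)) ^+ 2 / c)) + delta k.
  move=> K0k ak2 pn1.
  have wMk i : l2norm (u i - us) <= M by rewrite -wE.
  have eMk : l2norm (uh k - u k) + l2norm (e k) <= H by rewrite -etaE.
  have := halpern_step_sqr_le (a01 k) (b02 k) (qus k) (uS k) (wMk k) eMk.
  rewrite -!wE -etaE => /le_trans; apply.
  have t0 : 0 < n.+1%:R^-1 :> R by rewrite invr_gt0.
  have QMH : M + H + 1 <= Q by rewrite /Q lerD2r lerD2r; lra.
  have QMMH : M + (M + H) <= Q by rewrite /Q; lra.
  rewrite rhoE in pn1.
  have := halpern_step_ip_le (a01 k) (b02 k) (qus k) (uS k) t0 (qA k _ _ (pA n))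
    pn1 (wMk 0%N) (wMk k.+1) (wMk k) eMk QMH QMMH.
  rewrite invrK -rhoE; apply: absorb_linear => //; last by rewrite (ltW Q0).
  - by rewrite ak2; have /andP[->] := a01 k.
  - exact: bc.
  - by rewrite l2norm_ge0 etaE lerDr l2norm_ge0.
  - by rewrite mulr_ge0// addr_ge0.
have dsum n : \sum_(0 <= k < n) delta k <= (4 * (M + H) + 2 * Q) * H.
  by rewrite -mulr_sumr ler_wpM2l ?sum_eta//; lra.
have delta0 k : 0 <= delta k by rewrite /delta mulr_ge0//; lra.
have wsmall eps : 0 < eps -> exists K, forall k, (K <= k)%N -> w k ^+ 2 <= eps.
  (* [2 * h] is spent on the anchor term and [2 * h] on the recursion: [n0] is
     chosen first, for the distance of the path to its limit, and then the rank
     beyond which [alpha] compensates the constant that depends on [n0]. *)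
  move=> eps0; pose h := eps / 4; have h0 : 0 < h by rewrite divr_gt0.
  have rho0 : 0 < Num.min 1 (h / (4 * Q)).
    by rewrite lt_min ltr01 divr_gt0// mulr_gt0.
  have [n0 n0P] := (l2_cvgP _ _).1 pus _ rho0.
  have := n0P n0 (leqnn _); rewrite -rhoE lt_min ltr_pdivlMr ?mulr_gt0// =>
      /andP[pn1 pnh].
  pose B := 2 * Q ^+ 2 + 2 * (Q * (n0.+1%:R + 1)) ^+ 2 / c.
  have B0 : 0 < B.
    apply: ltr_pwDl; first by rewrite mulr_gt0// exprn_gt0.
    by rewrite divr_ge0 ?(ltW c0)// mulr_ge0// sqr_ge0.
  have sig0 : 0 < Num.min 2^-1 (h / B) by rewrite lt_min divr_gt0// andbT; lra.
  have a0 k : 0 <= alpha k by have /andP[/ltW] := a01 k.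
  have [K1 K1P] := (cvg0P a0).1 a_0 _ sig0.
  have h20 : 0 <= 2 * h by lra.
  have h2 : 0 < 2 * h by lra.
  have rec : exists K, forall k, (K <= k)%N ->
      w k.+1 ^+ 2 <= (1 - alpha k) * w k ^+ 2 + alpha k * (2 * h) + delta k.
    exists (maxn K0 K1) => k; rewrite geq_max => /andP[K0k K1k].
    have := K1P k K1k; rewrite lt_min ltr_pdivlMr// => /andP[ak2 akB].
    apply: le_trans (recur n0 k K0k (ltW ak2) (ltW pn1)) _.
    by rewrite lerD2r lerD2l ler_wpM2l// -/B; lra.
  have [K KP] := averaged_recursion (fun k => sqr_ge0 (w k)) a01 a_sum delta0
    dsum h20 rec h2.
  by exists K => k Kk; apply: le_trans (KP k Kk) _; rewrite /h; lra.
apply/l2_cvgP => eps eps0.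
have [|K KP] := wsmall ((eps / 2) ^+ 2); first by rewrite exprn_gt0// divr_gt0.
exists K => k Kk; rewrite -wE; have : w k <= eps / 2.
  by rewrite -(ler_pXn2r (n := 2)) ?nnegrE ?divr_ge0 ?(ltW eps0)//; exact: KP.
by lra.
Qed.

End halpern.

(** * Nonanticipativity and selections *)

Section stages.
Context d (T : measurableType d) (R : realType) (P : probability T R).
Context (N : nat) (n : 'I_N -> nat).
Let L2n := L2 P (\sum_(i < N) n i).

Lemma measurable_wrtP (S : set_system T) k (f : T -> 'rV[R]_k) :
  sigma_algebra setT S ->
  measurable_wrt S f <->
  forall j, @measurable_fun _ _ (g_sigma_algebraType S) R setT (fun w => f w ord0 j).
Proof.
move=> sS; have SE := measurable_g_measurableTypeE sS; split=> mf j.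
  by move=> _ B mB; rewrite SE; apply: (mf j); exists B.
by move=> _ [B mB <-]; rewrite -SE; exact: mf.
Qed.

(** A sub-sigma-algebra containing all negligible sets does not see
    modifications on a negligible set. *)
Lemma measurable_ae_eq (S : set_system T) (f g : T -> R) :
  sigma_algebra setT S -> P.-negligible `<=` S ->
  {ae P, forall w, f w = g w} ->
  @measurable_fun _ _ (g_sigma_algebraType S) R setT f ->
  @measurable_fun _ _ (g_sigma_algebraType S) R setT g.
Proof.
move=> sS nS fg mf _ B mB; have SE := measurable_g_measurableTypeE sS.
pose Z := [set w | ~ (f w = g w)].
have ZS (Y : set T) : @measurable _ (g_sigma_algebraType S) (Y `&` Z).
  rewrite SE; apply: nS; apply: negligibleS fg; exact: subIsetr.
have -> : setT `&` g @^-1` B =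
    ((setT `&` f @^-1` B) `\` (setT `&` Z)) `|` (g @^-1` B `&` Z).
  apply/seteqP; split=> [w [_ gB]|w [[[_ fB] nZ]|[gB _]]]; last by split.
    have [fgw|fgw] := pselect (f w = g w); last by right.
    by left; split; [split=> //; rewrite /preimage/= fgw|move=> [_]; exact].
  split=> //; suff fgw : f w = g w by rewrite /preimage/= -fgw.
  by apply: contrapT => fgw; apply: nZ.
by apply: measurableU; [apply: measurableD; [exact: mf|exact: ZS]|exact: ZS].
Qed.

Lemma block_coord (x : L2n) i w j : block x i w ord0 j = x w ord0 (tagnat.Rank i j).
Proof. by rewrite /block /submxrow mxE. Qed.

Lemma nonanticip_subspace (G : 'I_N -> set_system T) :
  is_filtration P G -> l2_subspace (nonanticip P G : set L2n).
Proof.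
move=> [sG _ _ _]; split=> [i|a x y Gx Gy i].
  apply/(measurable_wrtP _ (sG i)) => j.
  under eq_fun do rewrite block_coord.
  rewrite (_ : (fun _ => _) = cst 0); first exact: measurable_cst.
  by apply/funext => w; rewrite mxE.
apply/(measurable_wrtP _ (sG i)) => j.
have /(_ j) mx := (measurable_wrtP _ (sG i)).1 (Gx i).
have /(_ j) my := (measurable_wrtP _ (sG i)).1 (Gy i).
rewrite (_ : (fun _ => _) =
    (fun w => a * block x i w ord0 j + block y i w ord0 j)); last first.
  by apply/funext => w; rewrite !block_coord !l2coordE.
by apply: measurable_funD => //; apply: measurable_funM.
Qed.

(** The limit coincides almost everywhere with the pointwise upper limit of a
    subsequence, which is measurable for the stage sigma-algebra. *)
Lemma nonanticip_closed (G : 'I_N -> set_system T) :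
  is_filtration P G -> l2_closed (nonanticip P G : set L2n).
Proof.
move=> [sG nG _ _] u x Gu ux i.
have [phi uphi] := l2_cvg_subseq_ae ux.
apply/(measurable_wrtP _ (sG i)) => j.
pose f w := fine (limn_esup (fun k => (block (u (phi k)) i w ord0 j)%:E)).
apply: (@measurable_ae_eq (G i) f _ (sG i) (nG i)).
  apply: filterS uphi => w uw; rewrite block_coord /f.
  under [in LHS]eq_fun do rewrite block_coord.
  have : (fun k => (u (phi k) w ord0 (tagnat.Rank i j))%:E) @ \oo -->
      (x w ord0 (tagnat.Rank i j))%:E.
    by apply: cvg_EFin; [exact: nearW|exact: uw].
  by move=> /cvg_limn_einf_sup[_ ->].
apply: measurableT_comp; first exact: fine_measurable.
apply: measurable_fun_limn_esup => k; apply/measurable_EFinP.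
exact: (measurable_wrtP _ (sG i)).1 (Gu (phi k) i) j.
Qed.

Lemma selections_closed (C : forall i : 'I_N, T -> set 'rV[R]_(n i)) :
  (forall i w, closed (C i w)) -> l2_closed (selections P C : set L2n).
Proof.
move=> Cc u x Cu ux i.
have [phi uphi] := l2_cvg_subseq_ae ux.
have Cuphi : {ae P, forall w k, C i w (block (u (phi k)) i w)}.
  by apply/ae_foralln => k; exact: Cu.
apply: filterS2 uphi Cuphi => w uw Cw.
suff ucv : (fun k => block (u (phi k)) i w) @ \oo --> block x i w.
  by apply: (@closed_cvg _ _ _ _ _ (C i w) (Cc i w) _ _ ucv); exact: nearW.
apply/cvg_ballP => e e0.
have : \forall k \near \oo, forall j, ball (x w ord0 j) e (u (phi k) w ord0 j).
  by apply: filter_forall => j; move: (uw j) => /cvg_ballP; exact.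
apply: filterS => k uk; split=> // i' j; rewrite (ord1 i') !block_coord.
exact: uk.
Qed.

Lemma selections_convex (C : forall i : 'I_N, T -> set 'rV[R]_(n i)) :
  (forall i w, convex_set (C i w)) -> l2_convex (selections P C : set L2n).
Proof.
move=> Ccv x y t Cx Cy t01 i; apply: filterS2 (Cx i) (Cy i) => w Cxw Cyw.
rewrite (_ : block _ i w = t *: block x i w + (1 - t) *: block y i w); last first.
  by apply/rowP => j; rewrite !mxE/=.
have := Ccv i w _ _ (Itv01 (andP t01).1 (andP t01).2) (mem_set Cxw) (mem_set Cyw).
by rewrite inE.
Qed.
End stages.

(** * The partial inverse *)

Section partial_inverse.
Context d (T : measurableType d) (R : realType) (P : probability T R) (m : nat).
Context (F : L2 P m -> L2 P m) (C S : set (L2 P m)) (r : R).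
Implicit Types (u v p q x y z : L2 P m).

Lemma l2_closed_null (D : set (L2 P m)) x y :
  l2_closed D -> l2norm (x - y) = 0 -> D x -> D y.
Proof.
move=> Dc xy Dx; apply: Dc (fun=> Dx) _.
by apply: (l2_cvg_le (b := cst 0)) => [k|]; [rewrite xy|exact: cvg_cst].
Qed.

(** Seminorm closedness makes membership in [D] and in its normal cones
    independent of representatives. *)
Lemma normal_cone_null D x y u v : l2_closed D ->
  l2norm (x - y) = 0 -> l2norm (u - v) = 0 -> normal_cone D x u -> normal_cone D y v.
Proof.
move=> Dc xy uv [Dx nx]; split; first exact: l2_closed_null Dc xy Dx.
move=> q Dq; have := nx q Dq.
have -> : ip u (q - x) = ip (u - v) (q - x) - ip (x - y) v + ip v (q - y).
  by rewrite (ipC (x - y)) !ipE_linear; ring.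
by rewrite (ip_null _ uv) (ip_null _ xy) subrr add0r.
Qed.

Lemma pythagoras x y : S x -> orthocomplement S y ->
  l2norm (x + y) ^+ 2 = l2norm x ^+ 2 + l2norm y ^+ 2.
Proof.
move=> Sx Sy; rewrite !sqr_l2norm !ipE_linear (ipC y x) (Sy _ Sx).
by rewrite addr0 add0r.
Qed.

Lemma pythagoras_le x y : S x -> orthocomplement S y ->
  l2norm x <= l2norm (x + y) /\ l2norm y <= l2norm (x + y).
Proof.
move=> Sx Sy; have xy := pythagoras Sx Sy.
split; rewrite -(ler_pXn2r (n := 2)) ?nnegrE ?l2norm_ge0// xy.
  by rewrite lerDl sqr_ge0.
by rewrite lerDr sqr_ge0.
Qed.

(** Spingarn's partial inverse, with respect to the subspace [S], of the
    operator [r^-1 *: (F + normal_cone C)]: the components along the orthogonal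
    complement are exchanged between argument and value. Its zeros encode the
    solutions of the extensive form. *)
Definition partial_inverse p v := exists zS zM wS wM,
  [/\ S zS /\ S wS, orthocomplement S zM /\ orthocomplement S wM,
      p = zS + wM, v = wS + zM &
      normal_cone C (zS + zM) (r *: (wS + wM) - F (zS + zM))].

Hypotheses (r0 : 0 < r) (Ss : l2_subspace S) (Sc : l2_closed S).
Hypotheses (C0 : C !=set0) (Cc : l2_closed C) (Ccv : l2_convex C).
Hypothesis F_mono : forall x y, 0 <= ip (F x - F y) (x - y).
Variable L : R.
Hypothesis L0 : 0 < L.
Hypothesis F_lip : forall x y, l2norm (F x - F y) <= L * l2norm (x - y).

Let Ms : l2_subspace (orthocomplement S) := orthocomplement_subspace S.
Let Mc : l2_closed (orthocomplement S) := @orthocomplement_closed _ _ _ P m S.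

(** Exchanging the components along the orthogonal complement preserves the
    inner product of differences, since the cross terms vanish by orthogonality. *)
Lemma partial_inverse_monotone : monotone_graph partial_inverse.
Proof.
move=> p v p' v' [zS [zM [wS [wM [[SzS SwS] [MzM MwM] -> -> [Cz nz]]]]]].
move=> [zS' [zM' [wS' [wM' [[SzS' SwS'] [MzM' MwM'] -> -> [Cz' nz']]]]]].
have h1 := nz _ Cz'; have h2 := nz' _ Cz.
have h3 := F_mono (zS + zM) (zS' + zM').
have Sz := l2_subspaceB Ss SzS SzS'; have Sw := l2_subspaceB Ss SwS SwS'.
have Mz := l2_subspaceB Ms MzM MzM'; have Mw := l2_subspaceB Ms MwM MwM'.
have -> : zS + wM - (zS' + wM') = (zS - zS') + (wM - wM') by l2_ring.
have -> : wS + zM - (wS' + zM') = (wS - wS') + (zM - zM') by l2_ring.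
set z := zS + zM in h1 h2 h3; set z' := zS' + zM' in h1 h2 h3.
have h : 0 <= r * ip ((wS - wS') + (wM - wM')) ((zS - zS') + (zM - zM')).
  have -> : (wS - wS') + (wM - wM') = (wS + wM) - (wS' + wM') by l2_ring.
  have -> : (zS - zS') + (zM - zM') = z - z' by rewrite /z /z'; l2_ring.
  move: h1 h2 h3; clearbody z z'; move: (wS + wM) (wS' + wM') => w w'.
  move: (F z) (F z') => f f'.
  have -> : z' - z = - (z - z') by l2_ring.
  move: (z - z') => t.
  rewrite !ipE_linear.
  by move: (ip w t) (ip w' t) (ip f t) (ip f' t) => ? ? ? ?; lra.
move: h; rewrite (pmulr_rge0 _ r0).
move: (zS - zS') (wS - wS') (zM - zM') (wM - wM') Sz Sw Mz Mw.
move=> a b c e Sa Sb Mzc Mwe;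
    rewrite !ipE_linear (ipC e c) (ipC e a) (ipC b a) (ipC e b).
by rewrite (Mzc _ Sb) (Mzc _ Sa) (Mwe _ Sa) (Mwe _ Sb) !(addr0, add0r).
Qed.

Lemma partial_inverse_closed : closed_graph partial_inverse.
Proof.
move=> p v p' v' pv pp' vv'.
have [[Sp Mp] [Sv Mv]] := (orth_projP p' Ss Sc, orth_projP v' Ss Sc).
set zS := orth_proj S p' in Sp Mp; set wS := orth_proj S v' in Sv Mv.
exists zS, (v' - wS), wS, (p' - zS); split=> //; [by l2_ring|by l2_ring|].
have /choice[a aP] := pv; have /choice[b bP] := aP.
have /choice[a' a'P] := bP; have /choice[b' b'P] := a'P.
have aS : l2_cvg a zS /\ l2_cvg b' (p' - zS).
  split; apply: l2_cvg_le pp' => k; have [[Sa Sa'] [Mb Mb'] -> _ _] := b'P k.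
    have -> : a k + b' k - p' = (a k - zS) + (b' k - (p' - zS)) by l2_ring.
    by apply: (pythagoras_le (l2_subspaceB Ss Sa Sp) (l2_subspaceB Ms Mb' Mp)).1.
  have -> : a k + b' k - p' = (a k - zS) + (b' k - (p' - zS)) by l2_ring.
  by apply: (pythagoras_le (l2_subspaceB Ss Sa Sp) (l2_subspaceB Ms Mb' Mp)).2.
have bS : l2_cvg a' wS /\ l2_cvg b (v' - wS).
  split; apply: l2_cvg_le vv' => k; have [[Sa Sa'] [Mb Mb'] _ -> _] := b'P k.
    have -> : a' k + b k - v' = (a' k - wS) + (b k - (v' - wS)) by l2_ring.
    by apply: (pythagoras_le (l2_subspaceB Ss Sa' Sv) (l2_subspaceB Ms Mb Mv)).1.
  have -> : a' k + b k - v' = (a' k - wS) + (b k - (v' - wS)) by l2_ring.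
  by apply: (pythagoras_le (l2_subspaceB Ss Sa' Sv) (l2_subspaceB Ms Mb Mv)).2.
have zcv := l2_cvgD aS.1 bS.2; have wcv := l2_cvgZ r (l2_cvgD bS.1 aS.2).
have Fcv := l2_cvg_lipschitz F_lip zcv.
split.
  by apply: Cc zcv => k; have [_ _ _ _ [Ck _]] := b'P k.
move=> y Cy.
have := l2_cvg_ip (l2_cvgB wcv Fcv) (l2_cvgB (l2_cvg_cst y) zcv).
move=> cv; rewrite -(cvg_lim _ cv)//; apply: limr_le; first exact: cvgP cv.
by apply: nearW => k; have [_ _ _ _ [_ nk]] := b'P k; exact: nk.
Qed.

(** Split into components, [t *: (u - p)] in [A p] says that [z] solves the
    variational inequality on [C] of the operator [B] below, in which the
    component of [z] along [S] is weighted by [t] and the other one by [t^-1].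
    Both weights are at least [t], so that [B] is strongly monotone. *)
Lemma partial_inverse_resolvent u t : 0 < t <= 1 ->
  exists p, partial_inverse p (t *: (u - p)).
Proof.
move=> /andP[t0 t1].
have [Q QP] : {Q : L2 P m -> L2 P m | forall x, S (Q x) /\ orthocomplement S (x - Q x)}.
  by exists (orth_proj S) => x; exact: orth_projP.
pose b := r *: (t *: Q u + (u - Q u)).
pose B z := F z + r *: (t *: Q z + t^-1 *: (z - Q z)) - b.
have ti1 : t <= t^-1 by rewrite (le_trans t1)// invf_ge1.
have Qd x y : l2norm (Q x - Q y) <= l2norm (x - y) /\
    l2norm ((x - Q x) - (y - Q y)) <= l2norm (x - y).
  have [[Sx Mx] [Sy My]] := (QP x, QP y).
  have -> : x - y = (Q x - Q y) + ((x - Q x) - (y - Q y)) by l2_ring.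
  exact: pythagoras_le (l2_subspaceB Ss Sx Sy) (l2_subspaceB Ms Mx My).
have Bmono x y : r * t * ip (x - y) (x - y) <= ip (B x - B y) (x - y).
  have [[Sx Mx] [Sy My]] := (QP x, QP y).
  have Sxy := l2_subspaceB Ss Sx Sy; have Mxy := l2_subspaceB Ms Mx My.
  have := F_mono x y.
  have -> : B x - B y = (F x - F y) + r *: (t *: (Q x - Q y)
      + t^-1 *: ((x - Q x) - (y - Q y))).
    by rewrite /B; l2_ring.
  move=> h; rewrite [leRHS]ipDl -[leLHS]add0r; apply: lerD => //.
  have -> : x - y = (Q x - Q y) + ((x - Q x) - (y - Q y)) by l2_ring.
  move: (Q x - Q y) ((x - Q x) - (y - Q y)) Sxy Mxy => v w Sv Mw.
  rewrite ipZl -mulrA ler_pM2l//.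
  rewrite !ipE_linear (ipC w v) (Mw _ Sv) !(mulr0, addr0, add0r) mulrDr lerD2l.
  by rewrite ler_wpM2r ?ip_ge0.
have Blip x y : l2norm (B x - B y) <= (L + r * (t + t^-1)) * l2norm (x - y).
  have -> : B x - B y = (F x - F y) + r *: (t *: (Q x - Q y)
      + t^-1 *: ((x - Q x) - (y - Q y))).
    by rewrite /B; l2_ring.
  apply: le_trans (ler_l2normD _ _) _; rewrite mulrDl lerD ?F_lip//.
  rewrite l2normZ gtr0_norm// -mulrA ler_pM2l//.
  apply: le_trans (ler_l2normD _ _) _; rewrite !l2normZ !gtr0_norm ?invr_gt0// mulrDl.
  have [h1 h2] := Qd x y.
  by apply: lerD; rewrite ler_pM2l ?invr_gt0.
have rt0 : 0 < r * t by rewrite mulr_gt0.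
have K0 : 0 <= L + r * (t + t^-1).
  by rewrite addr_ge0 ?(ltW L0)// mulr_ge0 ?(ltW r0)// addr_ge0 ?invr_ge0 ?(ltW t0).
have [z nz] := strongly_monotone_VI C0 Cc Ccv rt0 K0 Bmono Blip.
have [[Su Mu] [Sz Mz]] := (QP u, QP z).
exists (Q z + ((u - Q u) - t^-1 *: (z - Q z))).
exists (Q z), (z - Q z), (t *: (Q u - Q z)), ((u - Q u) - t^-1 *: (z - Q z)).
split=> //.
- by split; [exact: Sz|exact: l2_subspaceZ _ Ss (l2_subspaceB Ss Su Sz)].
- by split; [exact: Mz|exact: l2_subspaceB Ms Mu (l2_subspaceZ _ Ms Mz)].
- by apply: l2_ext => w j; rewrite !l2coordE; field; rewrite gt_eqF.
- have -> : Q z + (z - Q z) = z by l2_ring.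
  suff <- : - B z = r *: (t *: (Q u - Q z) + (u - Q u - t^-1 *: (z - Q z))) - F z by [].
  by rewrite /B /b; l2_ring.
Qed.

Lemma partial_inverse_of_SOL x y : C x -> S x -> orthocomplement S y ->
  normal_cone C x (- F x - y) -> partial_inverse (x - r^-1 *: y) 0.
Proof.
move=> Cx Sx My nx; exists x, 0, 0, (- (r^-1 *: y)); split=> //.
- by split=> //; exact: Ss.1.
- by split; [exact: Ms.1|exact: l2_subspaceN Ms (l2_subspaceZ _ Ms My)].
- by rewrite addr0.
- rewrite addr0 add0r (_ : r *: _ - _ = - F x - y)//.
  by apply: l2_ext => w j; rewrite !l2coordE; field; rewrite gt_eqF.
Qed.

(** At a zero, the component [zM] of [z] belongs to both [S] and its orthogonal
    complement, hence is null. *)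
Lemma partial_inverse_zero p : partial_inverse p 0 ->
  exists x y, [/\ p = x - r^-1 *: y, C x, S x, orthocomplement S y &
    normal_cone C x (- F x - y)].
Proof.
move=> [zS [zM [wS [wM [[SzS SwS] [MzM MwM] pE zw nz]]]]].
have wzE : wS = - zM by apply/eqP; rewrite -addr_eq0 -zw.
have zM0 : l2norm zM = 0.
  have := MzM _ SwS; rewrite wzE ipNl => /eqP; rewrite oppr_eq0 => /eqP z0.
  by rewrite /l2norm z0 sqrtr0.
have zz : l2norm (zS + zM - zS) = 0 by rewrite addrAC subrr add0r.
have Fz : l2norm (F (zS + zM) - F zS) = 0.
  apply/eqP; rewrite eq_le l2norm_ge0 andbT.
  by apply: le_trans (F_lip _ _) _; rewrite zz mulr0.
have nxs : normal_cone C zS (- F zS - (- (r *: wM))).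
  apply: normal_cone_null Cc zz _ nz; apply/eqP; rewrite eq_le l2norm_ge0 andbT.
  have -> : r *: (wS + wM) - F (zS + zM) - (- F zS - - (r *: wM)) =
      - (r *: zM) - (F (zS + zM) - F zS) by rewrite wzE; l2_ring.
  by apply: le_trans (ler_l2normB _ _) _; rewrite Fz l2normN l2normZ zM0 mulr0 addr0.
exists zS, (- (r *: wM)); split=> //.
- by rewrite pE scalerN opprK scalerA mulVf ?gt_eqF// scale1r.
- exact: nxs.1.
- exact: l2_subspaceN Ms (l2_subspaceZ _ Ms MwM).
Qed.

End partial_inverse.

(** * Series and limits in the extended reals *)

Section extended_series.
Context (R : realType).
Implicit Types a b : nat -> R.

Lemma summable_partial_sums a : (forall k, 0 <= a k) ->
  (\sum_(0 <= k <oo) (a k)%:E < +oo)%E ->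
  exists M, forall n, \sum_(0 <= k < n) a k <= M.
Proof.
move=> a0 ay; exists (fine (\sum_(0 <= k <oo) (a k)%:E)%E) => n.
have afin : (\sum_(0 <= k <oo) (a k)%:E)%E \is a fin_num.
  by rewrite ge0_fin_numE// nneseries_ge0// => k _ _; rewrite lee_fin.
rewrite -lee_fin fineK// -sumEFin; apply: nneseries_lim_ge => k _ _.
by rewrite lee_fin.
Qed.

Lemma divergent_partial_sums a : (forall k, 0 <= a k) ->
  (\sum_(0 <= k <oo) (a k)%:E = +oo)%E ->
  forall M, exists n, M <= \sum_(0 <= k < n) a k.
Proof.
move=> a0 ay M; apply: contrapT => nM.
have : (\sum_(0 <= k <oo) (a k)%:E <= M%:E)%E.
  apply: lime_le; first by apply: is_cvg_nneseries => k _ _; rewrite lee_fin.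
  apply: nearW => n; rewrite sumEFin lee_fin leNgt; apply/negP => /ltW Mn.
  by apply: nM; exists n.
by rewrite ay leye_eq.
Qed.

Lemma limn_einf_gt0_bound b : (0 < limn_einf (fun k => (b k)%:E))%E ->
  exists c K, 0 < c /\ forall k, (K <= k)%N -> c <= b k.
Proof.
move=> b0.
have [K bK] : exists K, (0 < einfs (fun k => (b k)%:E) K)%E.
  apply: contrapT => nK; move: b0; rewrite ltNge => /negP; apply.
  rewrite limn_einf_lim; apply: lime_le; first exact: is_cvg_einfs.
  by apply: nearW => K; rewrite leNgt; apply/negP => bK; apply: nK; exists K.
have bKle k : (K <= k)%N -> (einfs (fun k => (b k)%:E) K <= (b k)%:E)%E.
  by move=> Kk; apply: ereal_inf_lbound; exists k.
have bfin : einfs (fun k => (b k)%:E) K \is a fin_num.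
  rewrite fin_numElt (lt_trans _ bK) ?ltNyr//=.
  exact: le_lt_trans (bKle _ (leqnn K)) (ltry _).
exists (fine (einfs (fun k => (b k)%:E) K)), K; split.
  by rewrite -lte_fin fineK.
by move=> k Kk; rewrite -lee_fin fineK// bKle.
Qed.

Lemma limn_esup_lt_bound b (x : R) : (limn_esup (fun k => (b k)%:E) < x%:E)%E ->
  exists c K, 0 < c /\ forall k, (K <= k)%N -> b k <= x - c.
Proof.
move=> bx.
have [|c [K [c0 cK]]] := @limn_einf_gt0_bound (fun k => x - b k).
  rewrite (_ : (fun _ => _) = (fun k => x%:E + (- (b k)%:E))%E)//.
  rewrite limn_einf_shift// limn_einfN.
  by rewrite sube_gt0.
by exists c, K; split=> // k Kk; have := cK k Kk; lra.
Qed.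

Lemma relaxation_bound b :
  (0 < limn_einf (fun k => (b k)%:E))%E ->
  (limn_esup (fun k => (b k)%:E) < 2%:E)%E ->
  exists c K, 0 < c /\ forall k, (K <= k)%N -> c <= b k * (2 - b k).
Proof.
move=> /limn_einf_gt0_bound[c [K [c0 cK]]] /limn_esup_lt_bound[e [L [e0 eL]]].
exists (c * e), (maxn K L); split; first exact: mulr_gt0.
move=> k; rewrite geq_max => /andP[Kk Lk].
apply: ler_pM; [exact: ltW|exact: ltW|exact: cK|by have := eL k Lk; lra].
Qed.

End extended_series.

(** * The progressive hedging algorithm *)

Section progressive_hedging.
Context d (T : measurableType d) (R : realType) (P : probability T R) (m : nat).
Implicit Types (x y xt : nat -> L2 P m) (C S : set (L2 P m)).

Lemma extrapolate_subspace S theta a x k : l2_subspace S ->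
  S (prev_iterate a x k) -> S (x k) -> S (extrapolate theta a x k).
Proof.
move=> Ss Sp Sx; apply: l2_subspaceD => //.
by apply: l2_subspaceZ => //; exact: l2_subspaceB.
Qed.

(** Up to null sets, the projected step of the algorithm is the resolvent
    equation of the partial inverse at [xh - r^-1 *: yh], perturbed by [r^-1 *: e]. *)
Lemma halpern_PHA_cvg (F : L2 P m -> L2 P m) C S (L r : R)
    (alpha beta theta eps : nat -> R) (xm1 ym1 : L2 P m)
    x y xt (H1 H2 c : R) (K0 : nat) :
  l2_subspace S -> l2_closed S -> C !=set0 -> l2_closed C -> l2_convex C ->
  (forall v w, 0 <= ip (F v - F w) (v - w)) -> 0 < L ->
  (forall v w, l2norm (F v - F w) <= L * l2norm (v - w)) -> 0 < r ->
  (exists xs ys, [/\ C xs, S xs, orthocomplement S ys & normal_cone C xs (- F xs - ys)]) ->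
  (forall k, 0 < alpha k < 1) -> alpha @ \oo --> (0 : R) ->
  (forall M, exists n, M <= \sum_(0 <= k < n) alpha k) ->
  (forall k, 0 < beta k < 2) ->
  0 < c -> (forall k, (K0 <= k)%N -> c <= beta k * (2 - beta k)) ->
  (forall k, 0 <= theta k) ->
  (forall n, \sum_(0 <= k < n) eps k <= H1) ->
  (forall n, \sum_(0 <= k < n) theta k / alpha k *
    l2norm ((x k - prev_iterate xm1 x k) - r^-1 *: (y k - prev_iterate ym1 y k))
        <= H2) ->
  is_halpern_PHA F C S r alpha beta theta eps xm1 ym1 x y xt ->
  exists xs ys, [/\ C xs, S xs, orthocomplement S ys,
    normal_cone C xs (- F xs - ys) & l2_cvg x xs /\ l2_cvg y ys].
Proof.
move=> Ss Sc C0 Cc Ccv Fm L0 FL r0 [x' [y' [Cx' Sx' My' nx']]] a01 a_0 a_sum b02 c0 bc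
  th0 eps_sum th_sum [[Sxm1 Sx0] [Mym1 My0] alg].
set M := orthocomplement S in Mym1 My0 alg.
have Ms : l2_subspace M := orthocomplement_subspace S.
have Mc : l2_closed M := @orthocomplement_closed _ _ _ P m S.
have ri0 : 0 < r^-1 by rewrite invr_gt0.
have rri : r^-1 * r = 1 by rewrite mulVf ?gt_eqF.
have [xh xhE] : {xh | forall k, xh k = extrapolate theta xm1 x k}
    by exists (extrapolate theta xm1 x).
have [yh yhE] : {yh | forall k, yh k = extrapolate theta ym1 y k}
    by exists (extrapolate theta ym1 y).
have [z zE] : {z | forall k, z k = metric_proj C (xh k - r^-1 *: (F (xt k) + yh k))}.
  by exists (fun k => metric_proj C (xh k - r^-1 *: (F (xt k) + yh k))).
have [e eE] : {e | forall k, e k = F (xt k) - F (z k)} by exists (fun k =>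
    F (xt k) - F (z k)).
have [Q QP] : {Q : L2 P m ->
    L2 P m | forall v, S (Q v) /\ M (v - Q v) /\ orth_proj S v = Q v}.
  exists (orth_proj S) => v; have [Sv Mv] := orth_projP v Ss Sc.
  by split; [exact: Sv|split; [exact: Mv|exact: erefl]].
have [QM QMP] : {QM : L2 P m ->
    L2 P m | forall v, M (QM v) /\ l2norm (QM v - (v - Q v)) = 0
    /\ orth_proj M v = QM v}.
  exists (orth_proj M) => v; have [Mv _] := orth_projP v Ms Mc.
  split; [exact: Mv|split; [|exact: erefl]].
  by have := orth_proj_complE v Ss Sc; have [_ [_ ->]] := QP v.
have nz k : normal_cone C (z k) (xh k - r^-1 *: (F (xt k) + yh k) - z k).
  by rewrite zE; apply: metric_proj_normal_cone => //; exact: metric_projP.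
have xtz k : l2norm (xt k - z k) <= eps k.
  by have [] := alg k; rewrite -xhE -yhE -zE.
pose X k := alpha k *: x 0%N + (1 - alpha k) *: ((1 - beta k) *: xh k
    + beta k *: Q (z k)).
pose Y k := alpha k *: y 0%N + (1 - alpha k) *: ((1 - beta k) *: yh k
  + beta k *: (yh k + r *: QM (z k) + QM (e k))).
have xS k : l2norm (x k.+1 - X k) = 0.
  have [_ + _] := alg k; rewrite -xhE -yhE -zE.
  have [_ [_ ->]] := QP (z k); exact: l2norm_ae_eq.
have yS k : l2norm (y k.+1 - Y k) = 0.
  have [_ _] := alg k; rewrite -xhE -yhE -zE -eE.
  have [_ [_ ->]] := QMP (z k); have [_ [_ ->]] := QMP (e k); exact: l2norm_ae_eq.
have inS k : (S (x k) /\ S (prev_iterate xm1 x k)) /\ (M (y k) /\ M (prev_iterate ym1 y k)).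
  elim: k => [//|k [[Sx Sxp] [My Myp]]]; split; split=> //.
    apply: l2_closed_null Sc _ _; first by rewrite l2distC; exact: xS.
    have Sxh : S (xh k) by rewrite xhE; exact: extrapolate_subspace.
    have [Sz _] := QP (z k).
    exact (l2_subspaceD Ss (l2_subspaceZ _ Ss Sx0) (l2_subspaceZ _ Ss
      (l2_subspaceD Ss (l2_subspaceZ _ Ss Sxh) (l2_subspaceZ _ Ss Sz)))).
  apply: l2_closed_null Mc _ _; first by rewrite l2distC; exact: yS.
  have Myh : M (yh k) by rewrite yhE; exact: extrapolate_subspace _ Ms Myp My.
  have [Mz _] := QMP (z k); have [Me _] := QMP (e k).
  exact (l2_subspaceD Ms (l2_subspaceZ _ Ms My0) (l2_subspaceZ _ Ms
    (l2_subspaceD Ms (l2_subspaceZ _ Ms Myh) (l2_subspaceZ _ Ms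
      (l2_subspaceD Ms (l2_subspaceD Ms Myh (l2_subspaceZ _ Ms Mz)) Me))))).
have Sxh k : S (xh k).
  by rewrite xhE; have [[Sx Sxp] _] := inS k; exact: extrapolate_subspace.
have Myh k : M (yh k).
  by rewrite yhE; have [_ [My Myp]] := inS k; exact: extrapolate_subspace _ Ms Myp My.
pose u k := x k - r^-1 *: y k.
pose uh k := xh k - r^-1 *: yh k.
pose re k := r^-1 *: e k.
(* The output of the resolvent at [uh k - re k]. *)
pose q0 k := Q (z k) + (- (r^-1 *: yh k) - (z k - Q (z k)) - r^-1 *: (e k - Q (e k))).
have q0A k : partial_inverse F C S r (q0 k) (uh k - re k - q0 k).
  have [Sz [Mz _]] := QP (z k); have [Se [Me _]] := QP (e k).
  exists (Q (z k)), (z k - Q (z k)), (xh k - Q (z k) - r^-1 *: Q (e k)),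
    (- (r^-1 *: yh k) - (z k - Q (z k)) - r^-1 *: (e k - Q (e k))).
  split=> //.
  - split; first exact: Sz.
    exact: l2_subspaceB Ss (l2_subspaceB Ss (Sxh k) Sz) (l2_subspaceZ _ Ss Se).
  - split; first exact: Mz.
    exact (l2_subspaceB Ms (l2_subspaceB Ms
      (l2_subspaceN Ms (l2_subspaceZ _ Ms (Myh k))) Mz) (l2_subspaceZ _ Ms Me)).
  - by rewrite /q0 /uh /re; move: (Q (z k)) (Q (e k)) => ? ?; l2_ring.
  - rewrite (_ : Q (z k) + (z k - Q (z k)) = z k); last by move: (Q _) => ?; l2_ring.
    have [Cz nzk] := nz k; split; first exact: Cz.
    move=> p Cp; have := nzk p Cp; rewrite -(pmulr_rle0 _ r0) -ipZl.
    rewrite (_ : r *: (xh k - r^-1 *: (F (xt k) + yh k) - z k) =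
      r *: (xh k - Q (z k) - r^-1 *: Q (e k) + (- (r^-1 *: yh k) - (z k - Q (z k))
        - r^-1 *: (e k - Q (e k)))) - F (z k))//.
    move: (Q (z k)) (Q (e k)) => ? ?; rewrite eE.
    move: (F (z k)) (F (xt k)) => ? ?.
    by apply: l2_ext => w j; rewrite !l2coordE; field; rewrite gt_eqF.
(* The update holds only almost everywhere; solving it for [q] makes it exact
   and leaves the discrepancy in [q], as a null difference with [q0]. *)
pose q k := (beta k)^-1 *:
  ((1 - alpha k)^-1 *: (u k.+1 - alpha k *: u 0%N) - (1 - beta k) *: uh k).
have uS k : u k.+1 = alpha k *: u 0%N + (1 - alpha k) *: ((1 - beta k) *: uh k
    + beta k *: q k).
  have /andP[b0 _] := b02 k; have /andP[_ a1] := a01 k.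
  rewrite /q; move: (u _) (u _) (uh _) => ? ? ?.
  apply: l2_ext => w j; rewrite !l2coordE; field.
  by rewrite subr_eq0 [1 == _]eq_sym lt_eqF// gt_eqF.
have qq0 k : l2norm (q k - q0 k) = 0.
  have /andP[b0 _] := b02 k; have /andP[_ a1] := a01 k.
  have [_ [Mz _]] := QMP (z k); have [_ [Me _]] := QMP (e k).
  have -> : q k - q0 k = ((beta k)^-1 * (1 - alpha k)^-1) *: ((x k.+1 - X k)
      - r^-1 *: (y k.+1 - Y k)) - (QM (z k) - (z k - Q (z k)))
      - r^-1 *: (QM (e k) - (e k - Q (e k))).
    rewrite /q /q0 /u /uh /X /Y.
    move: (Q (z k)) (QM (z k)) (Q (e k)) (QM (e k)) => ? ? ? ?.
    apply: l2_ext => ? ?; rewrite !l2coordE; field.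
    by rewrite !gt_eqF ?subr_gt0.
  apply/eqP; rewrite eq_le l2norm_ge0 andbT.
  apply: le_trans (ler_l2normB _ _) _; rewrite l2normZ Me mulr0 addr0.
  apply: le_trans (ler_l2normB _ _) _; rewrite Mz addr0 l2normZ.
  rewrite -[leRHS](mulr0 `|(beta k)^-1 * (1 - alpha k)^-1|) ler_wpM2l//.
  apply: le_trans (ler_l2normB _ _) _; by rewrite xS l2normZ yS mulr0 addr0.
have qA k p v : partial_inverse F C S r p v -> 0
    <= ip (q k - p) (uh k - re k - q k - v).
  move=> Apv; have := partial_inverse_monotone r0 Ss Fm (q0A k) Apv.
  have -> : ip (q0 k - p) (uh k - re k - q0 k - v) =
     ip (q k - p) (uh k - re k - q k - v)
     - ip (q k - q0 k) (uh k - re k - q k - v) + ip (q k - q0 k) (q0 k - p).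
    rewrite (ipC (q k - q0 k) (q0 k - p)).
    rewrite (_ : uh k - re k - q0 k - v = (uh k - re k - q k - v) + (q k - q0 k));
        last by l2_ring.
    rewrite (_ : q k - p = (q0 k - p) + (q k - q0 k)); last by l2_ring.
    by move: (q0 k - p) (q k - q0 k) (_ - v) => ? ? ?; rewrite !ipE_linear; ring.
  by rewrite !(ip_null _ (qq0 k)) subr0 addr0.
have sumH n : \sum_(0 <= k < n) (l2norm (uh k - u k) + l2norm (re k)) <= H2
    + r^-1 * L * H1.
  rewrite big_split/= lerD//.
    apply: le_trans (th_sum n); apply: ler_sum => k _.
    have -> : uh k - u k = theta k *: ((x k - prev_iterate xm1 x k)
        - r^-1 *: (y k - prev_iterate ym1 y k)).
      rewrite /uh /u xhE yhE /extrapolate.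
      by move: (prev_iterate _ _ _) (prev_iterate _ _ _) => ? ?; l2_ring.
    rewrite l2normZ ger0_norm// ler_wpM2r ?l2norm_ge0//.
    have /andP[ak0 ak1] := a01 k.
    by rewrite ler_pdivlMr// ler_piMr ?(ltW ak1).
  apply: (@le_trans _ _ (\sum_(0 <= k < n) r^-1 * L * eps k)).
    apply: ler_sum => k _; rewrite /re l2normZ gtr0_norm// -mulrA ler_pM2l// eE.
    by apply: le_trans (FL _ _) _; rewrite ler_pM2l.
  by rewrite -mulr_sumr ler_wpM2l// mulr_ge0 ?(ltW L0) ?(ltW ri0).
have A0 := partial_inverse_of_SOL r0 Ss Cx' Sx' My' nx'.
have Am : monotone_graph (partial_inverse F C S r).
  exact (@partial_inverse_monotone _ _ _ _ _ F C S r r0 Ss Fm).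
have Ac : closed_graph (partial_inverse F C S r).
  exact (@partial_inverse_closed _ _ _ _ _ F C S r Ss Sc Cc L FL).
have Ares w t :=
    @partial_inverse_resolvent _ _ _ _ _ F C S r r0 Ss Sc C0 Cc Ccv Fm L L0 FL w t.
have [us [Aus uus]] :=
    halpern_proximal_cvg Am Ac A0 Ares a01 a_0 a_sum b02 c0 bc sumH qA uS.
have [xs [ys [usE Cxs Sxs Mys nxs]]] := partial_inverse_zero r0 Cc FL Aus.
exists xs, ys; split=> //.
have ux k : l2norm (x k - xs) <= l2norm (u k - us) /\
    r^-1 * l2norm (y k - ys) <= l2norm (u k - us).
  have [[Sx _] [My _]] := inS k.
  have -> : u k - us = (x k - xs) + (- r^-1) *: (y k - ys) by rewrite usE /u; l2_ring.
  have [h1 h2] := pythagoras_le (l2_subspaceB Ss Sx Sxs)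
    (l2_subspaceZ (- r^-1) Ms (l2_subspaceB Ms My Mys)).
  by split=> //; move: h2; rewrite l2normZ normrN gtr0_norm.
split; first by apply: l2_cvg_le uus => k; exact: (ux k).1.
apply: (l2_cvg_le (b := fun k => r * l2norm (u k - us))) => [k|].
  by rewrite -ler_pdivrMl// (ux k).2.
rewrite -[0](mulr0 r); apply: cvgM; [exact: cvg_cst|exact: uus].
Qed.

End progressive_hedging.

Theorem theorem3p7 (d : measure_display) (T : measurableType d) (R : realType)
    (P : probability T R) (P_complete : measure_is_complete P)
    (N : nat) (N_ge1 : (1 <= N)%N)
    (n : 'I_N -> nat) (n_gt0 : forall i, (0 < n i)%N)
    (G : 'I_N -> set_system T) (G_filtration : is_filtration P G)
    (C : forall i : 'I_N, T -> set 'rV[R]_(n i))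
    (C_nonempty : forall i w, C i w !=set0)
    (C_closed : forall i w, closed (C i w))
    (C_convex : forall i w, convex_set (C i w))
    (C_measurable : forall i, measurable_setvalued (G i) (C i))
    (selections_nonempty : selections P C !=set0)
    (F : L2 P (\sum_(i < N) n i) -> L2 P (\sum_(i < N) n i))
    (SOL_nonempty : SOL F (selections P C) (nonanticip P G) !=set0)
    (F_monotone : forall x y, 0 <= ip (F x - F y) (x - y))
    (LF : R) (LF_gt0 : 0 < LF)
    (F_lipschitz : forall x y, l2norm (F x - F y) <= LF * l2norm (x - y))
    (r : R) (r_gt0 : 0 < r)
    (alpha beta theta eps : nat -> R)
    (alpha_itv : forall k, 0 < alpha k < 1)
    (alpha_cvg0 : alpha @ \oo --> (0 : R))
    (alpha_sum : (\sum_(0 <= k <oo) (alpha k)%:E = +oo)%E)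
    (beta_itv : forall k, 0 < beta k < 2)
    (beta_liminf : (0 < limn_einf (fun k => (beta k)%:E))%E)
    (beta_limsup : (limn_esup (fun k => (beta k)%:E) < 2%:E)%E)
    (theta_itv : forall k, 0 <= theta k < 1)
    (eps_ge0 : forall k, 0 <= eps k)
    (eps_sum : (\sum_(0 <= k <oo) (eps k)%:E < +oo)%E)
    (xm1 ym1 : L2 P (\sum_(i < N) n i))
    (x y xt : nat -> L2 P (\sum_(i < N) n i))
    (xy_alg : is_halpern_PHA F (selections P C) (nonanticip P G) r
      alpha beta theta eps xm1 ym1 x y xt)
    (theta_sum : (\sum_(0 <= k <oo) (theta k / alpha k *
        l2norm ((x k - prev_iterate xm1 x k) - r^-1 *: (y k - prev_iterate ym1 y k)))%:E
      < +oo)%E) :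
  exists xs ys : L2 P (\sum_(i < N) n i),
    [/\ SOL F (selections P C) (nonanticip P G) (xs, ys),
        (fun k => l2norm2 (x k - xs, y k - ys)) @ \oo --> (0 : R),
        (fun k => l2norm (x k - xs)) @ \oo --> (0 : R) &
        is_SVI_solution F (selections P C) (nonanticip P G) xs].
Proof.
have [a0 b0] : (forall k, 0 <= alpha k) /\ (forall k, 0 <= beta k).
  by split=> k; [have /andP[/ltW] := alpha_itv k|have /andP[/ltW] := beta_itv k].
have t0 k : 0 <= theta k by have /andP[] := theta_itv k.
have [H1 eps_le] := summable_partial_sums eps_ge0 eps_sum.
have [|H2 theta_le] := summable_partial_sums _ theta_sum.
  by move=> k; rewrite mulr_ge0 ?l2norm_ge0// divr_ge0.
have alpha_dvg := divergent_partial_sums a0 alpha_sum.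
have [c [K0 [c0 beta_ge]]] := relaxation_bound beta_liminf beta_limsup.
have [[x' y'] [Cx' Sx' My' nx']] := SOL_nonempty.
have [xs [ys [Cxs Sxs Mys nxs [xcv ycv]]]] := halpern_PHA_cvg
  (nonanticip_subspace n G_filtration) (nonanticip_closed (n := n) G_filtration)
  selections_nonempty (selections_closed C_closed) (selections_convex C_convex)
  F_monotone LF_gt0 F_lipschitz r_gt0
  (ex_intro _ x' (ex_intro _ y' (And4 Cx' Sx' My' nx')))
  alpha_itv alpha_cvg0 alpha_dvg beta_itv c0 beta_ge t0 eps_le theta_le xy_alg.
exists xs, ys; split; [by split| |exact: xcv|].
- have sumcv : (fun k => l2norm (x k - xs) + l2norm (y k - ys)) @ \oo --> (0 : R).
    by rewrite -[0]addr0; apply: cvgD; [exact: xcv|exact: ycv].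
  apply: (squeeze_cvgr _ (cvg_cst 0) sumcv); apply: nearW => k.
  rewrite sqrtr_ge0/= -[leRHS]ger0_norm ?addr_ge0 ?l2norm_ge0// -sqrtr_sqr ler_wsqrtr//.
  by rewrite sqrrD addrAC lerDl mulrn_wge0// mulr_ge0 ?l2norm_ge0.
- split; first by split.
  split=> [|z [Cz Sz]]; first by split.
  have [_ /(_ z Cz)] := nxs.
  have -> : ip (- F xs - ys) (z - xs) = ip (- F xs) (z - xs) - (ip z ys - ip xs ys).
    by rewrite (ipC z ys) (ipC xs ys) !ipE_linear; ring.
  by rewrite (Mys _ Sz) (Mys _ Sxs) !subr0.
Qed.
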